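(* Let $d\ge 2$, let $S$ be a finite set, and let $\nu\in I_d(S)$ be a typical process. Let $h(\mathrm{star}_d)$ denote the entropy of the joint marginal distribution of $\nu$ on a star of degree $d$ in $T_d$ (a vertex together with its $d$ neighbors), and let $h(\mathrm{edge})$ denote the entropy of the joint marginal distribution of $\nu$ on the two endpoints of an edge of $T_d$. Then $$h(\mathrm{star}_d)\ \ge\ \frac d2\,h(\mathrm{edge}).$$
   Context: $T_d$ is the infinite $d$-regular tree. For a finite set $F$, $I_d(F)$ is the set of Borel probability measures on $F^{V(T_d)}$ invariant under $\mathrm{Aut}(T_d)$. The entropy of a probability distribution on a finite set with probabilities $p_1,\dots,p_K$ is $-\sum_i p_i\ln p_i$ (with $0\ln 0=0$). By invariance the entropies in the claim do not depend on the choice of star or edge. A sequence $\{G_i\}_{i=1}^\infty$ of finite $d$-regular graphs is a large girth sequence if for every $\varepsilon>0$ there is $n$ such that for all $i\ge n$ the probability that a uniformly random vertex of $G_i$ is contained in a cycle of length at most $\lceil 1/\varepsilon\rceil$ is at most $\varepsilon$. Colorings $f_i:V(G_i)\to F$ of a large girth sequence have Benjamini–Schramm limit $\mu\in I_d(F)$ if for every $r\in\mathbb N$ the law of the (isomorphism class of the) rooted $F$-colored ball of radius $r$ around a uniformly random vertex of $G_i$ converges weakly, as $i\to\infty$, to the law of the rooted $F$-colored ball of radius $r$ around a fixed vertex in a $\mu$-random coloring of $T_d$. For a large girth sequence $\mathcal S=\{G_i\}$, $[\mathcal S]_F$ is the set of all $\mu\in I_d(F)$ arising as Benjamini–Schramm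 limits of some sequence of $F$-colorings of $\mathcal S$. A process $\mu\in I_d(F)$ is typical if there is a fixed sequence of positive integers $n_i\to\infty$ (with $dn_i$ even) such that, for independent uniformly random $d$-regular graphs $\mathbb G_{n_i}$ on $n_i$ labelled vertices, $\mu\in[\{\mathbb G_{n_i}\}_{i=1}^\infty]_F$ holds with probability $1$. *)

(* Defs.v *)
From HB Require Import structures.
From mathcomp Require Import all_boot all_order all_algebra.
From mathcomp Require Import all_classical all_reals all_analysis.
Import Order.TTheory GRing.Theory Num.Theory.
Import numFieldNormedType.Exports.

Set Implicit Arguments.
Unset Strict Implicit.
Unset Printing Implicit Defensive.

Local Open Scope classical_set_scope.
Local Open Scope ring_scope.

(* Measurable types of the library carry a point. For an empty color set there
   is no probability measure on colorings, so nothing is lost. *)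
#[short(type="pfinType")]
HB.structure Definition PointedFinite := {T of Finite T & Pointed T}.

(* The d-regular tree is the Cayley graph of the free product of d copies of
   Z/2: vertices are the words in 'I_d without two equal consecutive letters,
   and the i-th neighbor of w is the reduced form of i :: w. *)
Definition reduced d (w : seq 'I_d) := sorted (fun i j => i != j) w.

Definition tree d : Type := {w : seq 'I_d | reduced w}.

HB.instance Definition _ d := Countable.on (tree d).

Definition tree_root d : tree d := exist (fun w => reduced w) [::] isT.

Definition nbr_word d (w : seq 'I_d) (i : 'I_d) : seq 'I_d :=
  if w is j :: w' then (if i == j then w' else i :: w) else [:: i].

Lemma nbr_word_reduced d (w : seq 'I_d) i : reduced w -> reduced (nbr_word w i).
Proof.
case: w => [|j w] //= rw; case: eqVneq => [_|ij] /=; last by rewrite ij.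
exact: path_sorted rw.
Qed.

Definition nbr d (v : tree d) (i : 'I_d) : tree d :=
  exist (fun w => reduced w) _ (nbr_word_reduced i (valP v)).

Definition tree_adj d : rel (tree d) := fun u v => [exists i, v == nbr u i].

Lemma nbrK d (i : 'I_d) : involutive (fun v : tree d => nbr v i).
Proof.
move=> [w rw]; apply/val_inj => /=.
case: w rw => [|j w] /= rw; first by rewrite eqxx.
case: (eqVneq i j) => [->|_] /=; last by rewrite eqxx.
by case: w rw => [|k w] //= /andP[/negPf -> _].
Qed.

Lemma nbr_inj d (v : tree d) : injective (nbr v).
Proof.
move=> i j /(congr1 val) /=; case: v => -[|k w] /= rw; first by case.
have grow l l' : w <> [:: l, l' & w].
  by move/(congr1 size)/eqP; rewrite /= -addn2 -{1}[size w]addn0 eqn_add2l.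
case: (eqVneq i k) => [->|_]; case: (eqVneq j k) => [->|_] //=.
- by move/grow.
- by move/esym/grow.
- by case.
Qed.

Lemma tree_adj_sym d : symmetric (@tree_adj d).
Proof.
by move=> u v; apply/existsP/existsP => -[i /eqP ->]; exists i; rewrite nbrK.
Qed.

Lemma tree_adjE d (u v : tree d) :
  tree_adj u v = [exists i, (val v == i :: val u) || (val u == i :: val v)].
Proof.
case: u v => [u ru] [v rv]; rewrite /tree_adj /=.
apply/existsP/existsP => -[i]; last first.
  case/orP=> /eqP /= e; subst; exists i; apply/eqP/val_inj => /=.
    by case: u ru rv => [|j u] //= ru /andP[/negPf ->].
  by rewrite eqxx.
move/eqP/(congr1 val) => /= ->; exists i; case: u ru => [|j u] /= ru; rewrite ?eqxx //.
by case: (eqVneq i j) => [->|_]; rewrite eqxx ?orbT.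
Qed.

Lemma tree_adj_connected d (u v : tree d) :
  exists2 p, path (@tree_adj d) u p & v = last u p.
Proof.
have toroot w : exists2 p, path (@tree_adj d) w p & tree_root d = last w p.
  case: w => w; elim: w => [|i w IHw] rw.
    by exists [::] => //; apply/val_inj.
  have [p pp lp] := IHw (path_sorted rw).
  exists (exist (fun w => reduced w) w (path_sorted rw) :: p) => //=.
  by rewrite pp andbT tree_adjE; apply/existsP; exists i; rewrite /= eqxx orbT.
have [p pp lp] := toroot u; have [q pq lq] := toroot v.
have e : path (@tree_adj d) (last v q) (rev (belast v q)).
  by rewrite rev_path; under eq_path do rewrite tree_adj_sym.
exists (p ++ rev (belast v q)); first by rewrite cat_path pp -lp lq.
rewrite last_cat -lp lq; case: q {pq lq e} => [|x q] //=.
by rewrite rev_cons last_rcons.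
Qed.

Lemma tree_acyclic d (c : seq (tree d)) :
  ucycle (@tree_adj d) c -> (size c <= 2)%N.
Proof.
move=> /andP[cc uc]; rewrite leqNgt; apply/negP => c3.
pose len (v : tree d) := size (val v).
have [x0 x0c] : exists x, x \in c.
  by case: c c3 {cc uc} => [|x c] // _; exists x; rewrite mem_head.
have [x xc xmax] : exists2 x, x \in c & forall y, y \in c -> (len y <= len x)%N.
  pose P n := has (fun x => len x == n) c.
  have exP : exists n, P n by exists (len x0); apply/hasP; exists x0.
  have ubP n : P n -> (n <= \sum_(y <- c) len y)%N.
    by case/hasP => y yc /eqP <-; rewrite (big_rem y) //= leq_addr.
  have [m /hasP[x xc /eqP xm] mmax] := ex_maxnP exP ubP.
  exists x => // y yc; rewrite xm; apply: mmax; apply/hasP; by exists y.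
have down y : y \in c -> tree_adj x y -> behead (val x) = val y.
  move=> yc; rewrite tree_adjE => /existsP[k /orP[] /eqP e]; last by rewrite e.
  by have := xmax _ yc; rewrite /len e ltnn.
have [i c' def_c] := rot_to xc.
move: c3 cc uc down; rewrite -(size_rot i) -(rot_cycle i) -(rot_uniq i) def_c.
have mem_c y : (y \in c) = (y \in x :: c') by rewrite -def_c mem_rot.
case: c' {def_c} mem_c => [|y [|z c']] mem_c //= _.
rewrite rcons_path => /andP[xy /and3P[_ _ zx]] /and3P[_ yzc _] down.
have lz : last z c' \in z :: c' by apply: mem_last.
have := down _ _ xy; rewrite mem_c !in_cons eqxx orbT => /(_ isT).
rewrite tree_adj_sym in zx; rewrite (down (last z c')) //; first last.
  by rewrite mem_c in_cons in_cons lz !orbT.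
by move/esym/val_inj => e; rewrite e lz in yzc.
Qed.

Definition tree_aut d (phi : tree d -> tree d) :=
  bijective phi /\ forall u v, tree_adj (phi u) (phi v) = tree_adj u v.

Definition star d (o : tree d) : seq (tree d) :=
  o :: [seq nbr o i | i <- enum 'I_d].

Definition coloring (d : nat) (S : pfinType) : Type :=
  prod_topology (fun _ : tree d => discrete_topology S).

HB.instance Definition _ d (S : pfinType) := Topological.on (coloring d S).
HB.instance Definition _ d (S : pfinType) :=
  isPointed.Build (coloring d S) (fun=> point).

Definition borel_coloring (d : nat) (S : pfinType) :=
  g_sigma_algebraType (@open (coloring d S)).

HB.instance Definition _ d (S : pfinType) := Measurable.on (borel_coloring d S).

Definition invariant_process (R : realType) (d : nat) (S : pfinType)
    (mu : probability (borel_coloring d S) R) :=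
  forall phi : tree d -> tree d, tree_aut phi ->
  forall A : set (borel_coloring d S), measurable A ->
    mu [set x | A (fun v => x (phi v))] = mu A.

(* ln 0 = 0 in the library. *)
Definition entropy (R : realType) (T : finType) (p : T -> R) : R :=
  - \sum_(t : T) p t * ln (p t).

Definition marginal (R : realType) (d : nat) (S : pfinType)
    (mu : probability (borel_coloring d S) R) (s : seq (tree d))
    (a : (size s).-tuple S) : R :=
  fine (mu [set x | [seq x v | v <- s] = a]).

Arguments marginal {R d S} mu s a.

Definition joint_entropy (R : realType) (d : nat) (S : pfinType)
    (mu : probability (borel_coloring d S) R) (s : seq (tree d)) : R :=
  entropy (marginal mu s).

Record rcgraph (S : Type) := RCGraph {
  vertex : Type;
  adjacent : rel vertex;
  root : vertex;
  color : vertex -> S }.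

Definition rcgraph_iso (S : Type) (X Y : rcgraph S) :=
  exists h : vertex X -> vertex Y,
    [/\ bijective h, h (root X) = root Y,
        forall u v, adjacent (h u) (h v) = adjacent u v &
        forall u, color (h u) = color u].

Definition within (V : Type) (e : rel V) (r : nat) (u v : V) :=
  exists p : seq V, [/\ path e u p, last u p = v & (size p <= r)%N].

Lemma within_refl (V : Type) (e : rel V) r u : within e r u u.
Proof. by exists [::]. Qed.

Definition ball_at (S V : Type) (e : rel V) (c : V -> S) (r : nat) (o : V) :
    rcgraph S :=
  {| vertex := {v : V | within e r o v};
     adjacent := fun u v => e (sval u) (sval v);
     root := exist _ o (within_refl e r o);
     color := fun u => c (sval u) |}.

Definition regular_graph_axiom d n (A : {ffun 'I_n * 'I_n -> bool}) :=
  [forall u, [&& ~~ A (u, u), [forall v, A (u, v) == A (v, u)] &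
                 #|[set v | A (u, v)]%SET| == d]].

(* Simple graphs on the labelled vertices 0, ..., n - 1. *)
Definition dgraph d n : Type :=
  {A : {ffun 'I_n * 'I_n -> bool} | regular_graph_axiom d A}.

HB.instance Definition _ d n := Finite.on (dgraph d n).

Definition gadj d n (G : dgraph d n) : rel 'I_n := fun u v => val G (u, v).

Definition in_short_cycle d n (G : dgraph d n) (L : int) (v : 'I_n) :=
  exists c : seq 'I_n,
    [/\ ucycle (gadj G) c, (3 <= size c)%N, (size c)%:Z <= L & v \in c].

Definition large_girth (R : realType) (d : nat) (n_ : nat -> nat)
    (G : forall i, dgraph d (n_ i)) :=
  forall eps : R, 0 < eps -> exists n : nat, forall i, (n <= i)%N ->
    #|[set v | `[< in_short_cycle (G i) (Num.ceil eps^-1) v >]]%SET|%:R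
      / (n_ i)%:R <= eps.

(* Isomorphism classes of finite balls form a discrete space, so that weak
   convergence is tested against all bounded functions of the class. *)
Definition bs_limit (R : realType) (d : nat) (S : pfinType) (n_ : nat -> nat)
    (G : forall i, dgraph d (n_ i)) (f : forall i, 'I_(n_ i) -> S)
    (mu : probability (borel_coloring d S) R) :=
  forall (r : nat) (g : rcgraph S -> R),
    (forall X Y, rcgraph_iso X Y -> g X = g Y) ->
    (exists M : R, forall X, `|g X| <= M) ->
    (\sum_(v < n_ i) g (ball_at (gadj (G i)) (f i) r v)) / (n_ i)%:R
      @[i --> \oo] -->
    \int[mu]_x g (ball_at (@tree_adj d) x r (tree_root d)).

Definition bs_limit_set (R : realType) (d : nat) (S : pfinType) (n_ : nat -> nat)
    (G : forall i, dgraph d (n_ i)) (mu : probability (borel_coloring d S) R) :=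
  [/\ large_girth R G, invariant_process mu &
      exists f : forall i, 'I_(n_ i) -> S, bs_limit G f mu].

Definition uniform_rv (R : realType) (dO : measure_display)
    (O : measurableType dO) (P : probability O R) (T : finType) (X : O -> T) :=
  forall t : T, measurable (X @^-1` [set t]) /\
    P (X @^-1` [set t]) = (#|T|%:R^-1)%:E.

Definition mutually_independent (R : realType) (dO : measure_display)
    (O : measurableType dO) (P : probability O R) (T : nat -> finType)
    (X : forall i, O -> T i) :=
  forall (J : seq nat) (A : forall i, set (T i)), uniq J ->
    P (\bigcap_(i in [set` J]) (X i @^-1` A i)) =
    (\prod_(i <- J) P (X i @^-1` A i))%E.

(* For small n there may be no d-regular graph on n vertices; the existence of
   the random graphs excludes such values of n_ i. *)
Definition typical (R : realType) (d : nat) (S : pfinType)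
    (mu : probability (borel_coloring d S) R) :=
  exists n_ : nat -> nat,
    [/\ forall i, (0 < n_ i)%N, forall i, ~~ odd (d * n_ i),
        n_ i @[i --> \oo] --> \oo &
        exists (dO : measure_display) (O : measurableType dO)
          (P : probability O R) (G : forall i, O -> dgraph d (n_ i)),
          [/\ forall i, uniform_rv P (G i),
              mutually_independent P G &
              \forall w \ae P, bs_limit_set (fun i => G i w) mu]].

(* Main.v *)
(* First moment method in the configuration model. If nu is typical, then, for
   arbitrarily large n, at least half of the d-regular graphs on n vertices have
   a coloring whose star statistics are close to those of nu. Label the d
   half-edges at each vertex: a graph becomes a fixed point free involution of
   the n * d half-edges, in exactly d! ^ n ways. Up to subexponential factors,
   - there are at most exp (n h(star)) assignments of star types to the vertices with
     the prescribed statistics;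
   - a given assignment is induced by at most (prod_x m_x!) ^ (1/2) involutions,
     where m_x is the number of half-edges whose edge has color x, and
     m_x ~ n * d * P(edge = x);
   - there are at least ((n * d)!) ^ (1/2) involutions without loops and
     multiple edges: add edges greedily, and replace an edge xy by ax and by when
     only boundedly many half-edges a, b, ... are left.
   The ratio of the last two numbers is exp (- n * d / 2 * h(edge)), so the
   inequality says that the expected number of such colorings is not
   exponentially small. *)
Require Import Defs.
From mathcomp Require Import all_boot all_order fingroup perm all_algebra.
From mathcomp Require Import all_classical all_reals all_analysis.
From mathcomp Require Import zify ring lra.
Import Order.TTheory GRing.Theory Num.Theory.
Import numFieldNormedType.Exports.

Set Implicit Arguments.
Unset Strict Implicit.
Unset Printing Implicit Defensive.

(** * Involutions compatible with a coloring *)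

Section Pairings.
Variable H : finType.
Implicit Types (f g : {ffun H -> H}) (a b h : H).

(** A partial pairing is encoded as an involution whose fixed points are the unmatched elements.
    This operation is meant for two fixed points [a] and [b]. *)
Definition link f a b : {ffun H -> H} :=
  [ffun h => if h == a then b else if h == b then a else f h].

Definition unlink f a : {ffun H -> H} :=
  [ffun h => if (h == a) || (h == f a) then h else f h].

Lemma unlinkK f a : involutive f -> link (unlink f a) a (f a) = f.
Proof.
move=> fK; apply/ffunP => h; rewrite !ffunE.
case: eqVneq => [->//|ha]; by case: eqVneq => [->|hfa] //=; rewrite fK.
Qed.

Lemma unlink_involutive f a : involutive f -> involutive (unlink f a).
Proof.
move=> fK h; rewrite !ffunE; case: (boolP ((h == a) || (h == f a))) => [->//|].
rewrite negb_or => /andP[ha hfa].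
rewrite (can2_eq fK fK) (negPf hfa) (inj_eq (can_inj fK)) (negPf ha) /=; exact: fK.
Qed.

Lemma link_involutive f a b :
  involutive f -> f a = a -> f b = b -> involutive (link f a b).
Proof.
move=> fK fa fb h; rewrite !ffunE.
case: (eqVneq h a) => [->|ha].
  by rewrite eqxx; case: eqVneq => [->|].
case: (eqVneq h b) => [->|hb]; first by rewrite eqxx.
rewrite (can2_eq fK fK) fa (negPf ha) (can2_eq fK fK) fb (negPf hb); exact: fK.
Qed.

Section Coloured.
Variables (K : finType) (e : H -> K) (s : K -> K).
Hypothesis sK : involutive s.
Implicit Types A : {set H}.

(** Elements outside [A] are fixed, so that the induction on [A] stays within one type. In the
    application [e h] is the pair of colors seen from the half-edge [h], and [s] reverses the
    edge. *)
Definition color_pairings A : {set {ffun H -> H}} :=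
  [set f : {ffun H -> H} | [forall h, (f (f h) == h) &&
    (if h \in A then (f h != h) && (e (f h) == s (e h)) else f h == h)]].

Definition color_count A (x : K) := #|[set h in A | e h == x]|.

Lemma color_pairingsP A f :
  reflect [/\ involutive f,
              forall h, h \in A -> f h != h /\ e (f h) = s (e h) &
              forall h, h \notin A -> f h = h]
          (f \in color_pairings A).
Proof.
rewrite inE; apply: (iffP forallP) => [P|[fK fA fN] h].
  split=> h; have /andP[/eqP fK] := P h; first by [].
    by move=> + hA; rewrite hA => /andP[-> /eqP ->].
  by move=> + hA; rewrite (negPf hA) => /eqP.
rewrite fK eqxx /=; case: ifPn => hA; last by rewrite fN.
by have [-> ->] := fA h hA; rewrite eqxx.
Qed.

Lemma color_pairings_mem A f h : f \in color_pairings A -> h \in A -> f h \in A.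
Proof.
case/color_pairingsP => fK fA fN hA; apply/negPn/negP => /fN.
by rewrite fK => /esym/eqP; apply/negP; have [] := fA h hA.
Qed.

Lemma color_count_sym A f x :
  f \in color_pairings A -> color_count A (s x) = color_count A x.
Proof.
move=> fP; have [fK fA fN] := color_pairingsP _ _ fP.
rewrite /color_count -(card_imset _ (can_inj fK)); congr #|pred_of_set _|.
apply/finset.setP => h; rewrite inE; apply/imsetP/andP.
  case=> h'; rewrite inE => /andP[h'A /eqP eh'] ->; split.
    exact: color_pairings_mem fP h'A.
  by have [_ ->] := fA _ h'A; rewrite eh' sK.
case=> hA /eqP eh; exists (f h); last by rewrite fK.
by rewrite inE (color_pairings_mem fP hA); have [_ ->] := fA _ hA; rewrite eh /=.
Qed.

(** After expanding the square, each product [c i * c j] is at most the larger of the two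
    squares. *)
Lemma sum_sqr_le (I : finType) (B : {set I}) (c : I -> nat) Q :
  (forall i, i \in B -> c i ^ 2 <= Q) -> (\sum_(i in B) c i) ^ 2 <= #|B| ^ 2 * Q.
Proof.
move=> cQ; rewrite -mulnn big_distrl /= -mulnn -mulnA -sum_nat_const.
apply: leq_sum => i iB; rewrite big_distrr /= -sum_nat_const.
apply: leq_sum => j jB; have := cQ i iB; have := cQ j jB.
case: (leqP (c i) (c j)) => ij ? ?; nia.
Qed.

Lemma color_count_setD2 A h h' y : h \in A -> h' \in A -> h' != h ->
  color_count A y = color_count (A :\ h :\ h') y + (e h == y) + (e h' == y).
Proof.
move=> hA hA' hh'; rewrite /color_count.
rewrite (cardsD1 h) (cardsD1 h' (_ :\ h)) !inE hA hA' hh' /=.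
have -> : [set z in A | e z == y] :\ h :\ h' = [set z in A :\ h :\ h' | e z == y].
  apply/finset.setP => z; rewrite !inE.
  by case: (z == h); case: (z == h'); rewrite ?andbF.
by rewrite addnC [X in X + _]addnC addnAC.
Qed.

(** Once the partner of [h] is prescribed, a pairing is recovered from what remains after
    [unlink]. *)
Lemma card_color_pairings_at A h h' : h \in A ->
  #|[set f in color_pairings A | f h == h']| <= #|color_pairings (A :\ h :\ h')|.
Proof.
move=> hA; rewrite -(card_in_imset (f := fun f => unlink f h)).
  apply: subset_leq_card; apply/fintype.subsetP => g /imsetP[f].
  rewrite inE => /andP[/color_pairingsP [fK fA fN] /eqP fh] ->.
  apply/color_pairingsP; split; first exact: unlink_involutive.
    move=> z; rewrite !inE => /and3P[zh' zh zA]; rewrite !ffunE fh.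
    by rewrite (negPf zh) (negPf zh') /=; exact: fA.
  move=> z; rewrite !inE !ffunE fh; case: (z == h); case: (z == h') => //= ?.
  exact: fN.
move=> f g /setIdP[/color_pairingsP [fK _ _] /eqP fh].
move=> /setIdP[/color_pairingsP [gK _ _] /eqP gh] eq_un.
by rewrite -(unlinkK h fK) -(unlinkK h gK) eq_un fh gh.
Qed.

(** Induction on [A]: match one element [h], whose partner must have color [s (e h)], and compare
    the number of partners with the loss in the product. Squaring avoids the square root of a
    product of factorials. *)
Lemma card_color_pairings A :
  #|color_pairings A| ^ 2 <= \prod_x (color_count A x)`!.
Proof.
move: {2}#|A| (leqnn #|A|) => n; elim: n A => [|n IHn] A.
  rewrite leqn0 cards_eq0 => /eqP ->.
  have -> : \prod_x (color_count finset.set0 x)`! = 1.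
    by apply: big1 => x _; rewrite /color_count (_ : [set _ in _ | _] = finset.set0) ?cards0 //;
       apply/finset.setP => z; rewrite !inE.
  rewrite -(exp1n 2) leq_exp2r //; apply/card_le1_eqP => f g.
  move=> /color_pairingsP [_ _ fN] /color_pairingsP [_ _ gN].
  by apply/ffunP => h; rewrite fN ?gN ?inE.
move=> leAn; case: (set_0Vmem A) => [->|[h hA]].
  by apply: IHn; rewrite cards0.
(* Without pairings the bound is trivial; otherwise any pairing shows that [x] and [s x] have equal
   counts. *)
case: (set_0Vmem (color_pairings A)) => [->|[f0 f0P]].
  by rewrite cards0 exp0n.
set B := [set h' in A | (h' != h) && (e h' == s (e h))].
have cardE : #|color_pairings A| =
    \sum_(h' in B) #|[set f in color_pairings A | f h == h']|.
  rewrite -sum1_card (partition_big (fun f : {ffun H -> H} => f h) (mem B)) /=.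
    by apply: eq_bigr => h' _; rewrite -sum1_card; apply: eq_bigl => f; rewrite !inE.
  move=> f fP; rewrite !inE (color_pairings_mem fP hA) /=.
  by have /color_pairingsP [_ /(_ h hA)[-> ->] _] := fP; rewrite eqxx.
(* Whatever the partner, its removal together with [h] lowers the counts of [e h] and [s (e h)] by
   one each, so every choice leaves the same product. *)
set Q := \prod_x (color_count A x - (e h == x) - (s (e h) == x))`!.
have QE h' : h' \in B -> \prod_x (color_count (A :\ h :\ h') x)`! = Q.
  rewrite !inE => /and3P[h'A h'h /eqP eh'].
  apply: eq_bigr => x _; congr _`!.
  by rewrite (color_count_setD2 x hA h'A h'h) eh' -subnDA -addnA addnK.
rewrite cardE; apply: (@leq_trans (#|B| ^ 2 * Q)).
  apply: sum_sqr_le => h' h'B; rewrite -(QE h' h'B).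
  apply: (@leq_trans (#|color_pairings (A :\ h :\ h')| ^ 2)).
    by rewrite leq_exp2r // card_color_pairings_at.
  apply: IHn; move: h'B; rewrite !inE => /and3P[h'A h'h _].
  rewrite -ltnS; apply: leq_trans leAn.
  by rewrite (cardsD1 h A) hA (cardsD1 h' (A :\ h)) !inE h'h h'A.
have m_gt0 : 0 < color_count A (e h).
  by apply/card_gt0P; exists h; rewrite inE hA eqxx.
have m_sym := color_count_sym (e h) f0P.
rewrite /Q (bigD1 (e h)) //= [X in _ <= X](bigD1 (e h)) //=.
(* A self-reverse color of count [m] offers [m - 1] partners, while the product loses a factor
   [m * (m - 1)]. *)
have [sx|sx] := eqVneq (s (e h)) (e h).
  have -> : #|B| = (color_count A (e h)).-1.
    rewrite [in RHS]/color_count (cardsD1 h [set _ in A | _]) inE hA eqxx add1n /=.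
    congr #|pred_of_set _|; apply/finset.setP => z; rewrite !inE sx.
    by case: (z == h); rewrite ?andbF.
  rewrite sx eqxx mulnA; apply: leq_mul; last first.
    apply: leq_prod => x; rewrite eq_sym => /negPf ->; by rewrite !subn0.
  case: (color_count A (e h)) m_gt0 => [//|[|m]] _ /=; first by [].
  by rewrite !subSS !subn0 !factS mulnA leq_mul2r; apply/orP; right; nia.
(* Otherwise there are [m] partners, and the two colors, both of count [m], lose a factor [m]
   each. *)
have -> : #|B| = color_count A (e h).
  rewrite -m_sym /color_count; congr #|pred_of_set _|; apply/finset.setP => z.
  rewrite !inE; case: (eqVneq z h) => [->|//] /=.
  by rewrite (eq_sym (e h)) (negPf sx).
rewrite (bigD1 (s (e h))) ?sx //= [X in _ <= _ * X](bigD1 (s (e h))) ?sx //=.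
rewrite m_sym !eqxx (eq_sym (e h)) (negPf sx) !subn0.
rewrite !mulnA; apply: leq_mul; last first.
  apply: leq_prod => x /andP[]; rewrite eq_sym => /negPf ->.
  by rewrite eq_sym => /negPf ->; rewrite !subn0.
case: (color_count A (e h)) m_gt0 => [//|m] _.
by rewrite subSS subn0 !factS; nia.
Qed.

End Coloured.
End Pairings.

(** * Simple partial pairings of half-edges *)

Section SimplePairings.
Variables (V : finType) (d : nat).
Local Notation H := (V * 'I_d)%type.
Implicit Types (f g : {ffun H -> H}) (a b h : H) (u v : V).

Definition free f : {set H} := [set h | f h == h].

Definition padj f : rel V :=
  fun u v => [exists h, [&& f h != h, h.1 == u & (f h).1 == v]].

(** The three conditions make the matched half-edges a partial pairing without loops and without
    multiple edges on [V]. *)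
Definition simple f : bool :=
  [&& [forall h, f (f h) == h],
      [forall h, (f h != h) ==> ((f h).1 != h.1)] &
      [forall h, forall h', [&& f h != h, f h' != h', h.1 == h'.1 &
                                (f h).1 == (f h').1] ==> (h == h')]].

Lemma simpleP f :
  reflect [/\ involutive f,
              forall h, f h != h -> (f h).1 != h.1 &
              forall h h', f h != h -> f h' != h' -> h.1 = h'.1 ->
                (f h).1 = (f h').1 -> h = h']
          (simple f).
Proof.
apply: (iffP and3P) => [[/forallP fK /forallP fl /forallP fm]|[fK fl fm]].
  split=> [h|h hh|h h' hh hh' e e']; first exact/eqP.
    by have /implyP := fl h; exact.
  by have /forallP/(_ h') := fm h; rewrite hh hh' e e' !eqxx => /eqP.
split; apply/forallP => h; first by rewrite fK.
  by apply/implyP/fl.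
apply/forallP => h'; apply/implyP => /and4P[hh hh' /eqP e /eqP e'].
by apply/eqP; exact: fm.
Qed.

Lemma padjP f u v :
  reflect (exists h, [/\ f h != h, h.1 = u & (f h).1 = v]) (padj f u v).
Proof.
apply: (iffP existsP) => -[h].
  by case/and3P=> hh /eqP e /eqP e'; exists h.
by case=> hh e e'; exists h; rewrite hh e e' !eqxx.
Qed.

Lemma padj_sym f : involutive f -> symmetric (padj f).
Proof.
move=> fK; suff imp u v : padj f u v -> padj f v u by move=> u v; apply/idP/idP; exact: imp.
case/padjP=> h [hh e e']; apply/padjP; exists (f h).
by rewrite fK eq_sym hh.
Qed.

Lemma simple_unlink f a : simple f -> simple (unlink f a).
Proof.
case/simpleP => fK fl fm.
have un h : unlink f a h != h -> unlink f a h = f h.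
  by rewrite ffunE; case: ifP => //; rewrite eqxx.
apply/simpleP; split=> [|h hh|h h' hh hh']; first exact: unlink_involutive.
  by rewrite un //; apply: fl; rewrite -un.
by rewrite (un h hh) (un h' hh'); apply: fm; rewrite -un.
Qed.

Lemma simple_link f a b : simple f -> f a = a -> f b = b ->
  a.1 != b.1 -> ~~ padj f a.1 b.1 -> simple (link f a b).
Proof.
move=> /simpleP[fK fl fm] fa fb ab nab.
have nba : ~~ padj f b.1 a.1 by rewrite padj_sym.
have abx : a == b = false by apply: contraNF ab => /eqP ->.
apply/simpleP; split=> [|h|h h']; first exact: link_involutive.
  rewrite ffunE; case: (eqVneq h a) => [-> _|_]; first by rewrite eq_sym.
  by case: (eqVneq h b) => [-> //|_]; exact: fl.
rewrite !ffunE; case: (eqVneq h a) => [->|_].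
  case: (eqVneq h' a) => [->//|_]; case: (eqVneq h' b) => [->|_ _ hh' e e'].
    by move=> _ _ /eqP; rewrite (negPf ab).
  by case/negP: nab; apply/padjP; exists h'.
case: (eqVneq h b) => [->|_].
  case: (eqVneq h' a) => [->|_].
    by move=> _ _ /eqP; rewrite eq_sym (negPf ab).
  case: (eqVneq h' b) => [->//|_ _ hh' e e'].
  by case/negP: nba; apply/padjP; exists h'.
case: (eqVneq h' a) => [->|_ hh].
  by move=> hh _ e e'; case/negP: nab; apply/padjP; exists h.
case: (eqVneq h' b) => [->|_ hh'].
  by move=> _ e e'; case/negP: nba; apply/padjP; exists h.
exact: fm.
Qed.

Lemma free_link f a b : a != b -> free (link f a b) = free f :\ a :\ b.
Proof.
move=> ab; apply/finset.setP => h; rewrite !inE ffunE.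
case: (eqVneq h a) => [->|_]; first by rewrite eq_sym (negPf ab) andbF.
by case: (eqVneq h b) => [->|_] //=; rewrite (negPf ab).
Qed.

Lemma free_unlink f a : free (unlink f a) = a |: (f a |: free f).
Proof.
apply/finset.setP => h; rewrite !inE ffunE.
by case: (h == a) => /=; [|case: (h == f a)]; rewrite ?eqxx.
Qed.

Definition simple_pairings r : {set {ffun H -> H}} :=
  [set f | simple f && (#|free f| == r)].

Lemma card_half_edges_at u : #|[set h : H | h.1 == u]| = d.
Proof.
rewrite -[RHS]card_ord -(card_imset (f := fun i : 'I_d => (u, i))); last by move=> i j [].
congr #|pred_of_set _|; apply/finset.setP => -[v i]; rewrite inE; apply/eqP/imsetP => /=.
  by move=> ->; exists i.
by case=> j _ [].
Qed.

Lemma card_half_edges_adj f u : #|[set h : H | padj f u h.1]| <= d * d.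
Proof.
pose F (p : 'I_d * 'I_d) : H := ((f (u, p.1)).1, p.2).
apply: (@leq_trans #|F @: finset.setT|); last first.
  by apply: leq_trans (leq_imset_card _ _) _; rewrite cardsT card_prod card_ord.
apply/subset_leq_card/fintype.subsetP => -[v j]; rewrite inE => /padjP[[w i] [_ /= -> <-]].
by apply/imsetP; exists (i, j).
Qed.

Lemma card_dep_set (A C : finType) (X : {set A}) (E : A -> {set C}) :
  #|[set z : A * C | (z.1 \in X) && (z.2 \in E z.1)]| = \sum_(x in X) #|E x|.
Proof.
rewrite -sum1_card; under [RHS]eq_bigr do rewrite -sum1_card.
by rewrite pair_big_dep /=; apply: eq_bigl => z; rewrite inE.
Qed.

(** In the applications [E x] holds the possible moves from [x], and [E' y] the data needed to undo
    a move that led to [y]. *)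
Lemma leq_double_count (A B C C' : finType) (X : {set A}) (Y : {set B})
    (E : A -> {set C}) (E' : B -> {set C'}) (phi : A * C -> B * C') m m' :
  (forall x, x \in X -> m <= #|E x|) -> (forall y, y \in Y -> #|E' y| <= m') ->
  (forall x c, x \in X -> c \in E x ->
     ((phi (x, c)).1 \in Y) && ((phi (x, c)).2 \in E' (phi (x, c)).1)) ->
  (forall x c x' c', x \in X -> c \in E x -> x' \in X -> c' \in E x' ->
     phi (x, c) = phi (x', c') -> (x, c) = (x', c')) ->
  #|X| * m <= #|Y| * m'.
Proof.
move=> mE mE' phiP phiI.
apply: (@leq_trans (\sum_(x in X) #|E x|)).
  by rewrite -sum_nat_const; apply: leq_sum.
apply: (@leq_trans (\sum_(y in Y) #|E' y|)); last first.
  by rewrite -sum_nat_const; apply: leq_sum.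
rewrite -!card_dep_set -(card_in_imset (f := phi)).
  apply/subset_leq_card/fintype.subsetP => z /imsetP[[x c]].
  by rewrite !inE => /andP[/= xX cE] ->; exact: phiP.
by move=> [x c] [x' c']; rewrite !inE => /andP[? ?] /andP[? ?]; exact: phiI.
Qed.

Lemma linkK f a b : f a = a -> f b = b -> unlink (link f a b) a = f.
Proof.
move=> fa fb; apply/ffunP => h; rewrite !ffunE eqxx.
by case: (eqVneq h a) => [->//|_] /=; case: (eqVneq h b) => [->|].
Qed.

Let N := #|V| * d.
(** Bound on the forbidden partners of a free half-edge: [d] at its own vertex and at most [d * d]
    at adjacent vertices. *)
Let D := d + d * d.

Lemma card_half_edges : #|{: H}| = N.
Proof. by rewrite card_prod card_ord. Qed.

(** Double counting of the moves that join two free half-edges [a] and [b]. The move is undone from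
    the new pairing and [a], which is one of its [N - (r - 2)] matched half-edges. *)
Lemma simple_pairings_add r :
  #|simple_pairings r| * (r * (r - D)) <= #|simple_pairings (r - 2)| * (N - (r - 2)).
Proof.
pose ok f a := [set b in free f | (a.1 != b.1) && ~~ padj f a.1 b.1].
pose E f := [set p : H * H | (p.1 \in free f) && (p.2 \in ok f p.1)].
pose E' g := ~: free g.
pose phi (z : {ffun H -> H} * (H * H)) := (link z.1 z.2.1 z.2.2, z.2.1).
apply: (leq_double_count (E := E) (E' := E') (phi := phi)).
- move=> f; rewrite inE => /andP[_ /eqP fr].
  rewrite card_dep_set -{1}fr -sum_nat_const; apply: leq_sum => a _.
  rewrite leq_subLR -fr -(cardsID (ok f a)) addnC; apply: leq_add; last first.
    by apply/subset_leq_card/fintype.subsetP => b; rewrite !inE => /andP[].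
  apply: leq_trans (leq_add (eq_leq (card_half_edges_at a.1)) (card_half_edges_adj f a.1)).
  apply: leq_trans (leq_card_setU _ _).
  apply/subset_leq_card/fintype.subsetP => b; rewrite !inE => /andP[nb fb]; move: nb; rewrite fb /=.
  by rewrite negb_and !negbK eq_sym.
- move=> g; rewrite inE => /andP[_ /eqP gr]; rewrite /E'.
  by have := cardsC (free g); rewrite gr card_half_edges; lia.
- move=> f [a b]; rewrite !inE => /andP[fs /eqP fr] /= /and4P[/eqP fa /eqP fb ab nab].
  have axb : a != b by apply: contraNneq ab => ->.
  have aF : a \in free f by rewrite inE fa.
  have bF : b \in free f :\ a by rewrite !inE fb eqxx eq_sym axb.
  rewrite simple_link //= free_link // ffunE eqxx (eq_sym b) axb andbT -fr.
  by rewrite (cardsD1 a (free f)) aF (cardsD1 b (free f :\ a)) bF !add1n subn2.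
- move=> f [a b] f' [a' b']; rewrite !inE /=.
  move=> _ /and4P[/eqP fa /eqP fb _ _] _ /and4P[/eqP fa' /eqP fb' _ _] [eq_l eq_a].
  subst a'; have := congr1 (fun g : {ffun H -> H} => g a) eq_l; rewrite !ffunE eqxx => eq_b.
  by rewrite -(linkK fa fb) -(linkK fa' fb') eq_l eq_b.
Qed.

(** When few half-edges are free, all of them may forbid one another. A matched pair [h], [f h] is
    then broken up and its ends are joined to free half-edges [a] and [b]; at least one such move
    exists, and [a], [b] suffice to undo it. *)
Lemma simple_pairings_switch r : 2 <= r -> r + 3 * D < N ->
  #|simple_pairings r| <= #|simple_pairings (r - 2)| * N ^ 2.
Proof.
move=> r2 rN.
pose E f := [set p : H * H * H | [&& f p.1.1 == p.1.1, f p.1.2 == p.1.2,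
   p.1.1 != p.1.2, f p.2 != p.2,
   [&& p.2.1 != p.1.1.1, p.2.1 != p.1.2.1 & (f p.2).1 != p.1.2.1],
   ~~ padj f p.1.1.1 p.2.1 & ~~ padj f p.1.2.1 (f p.2).1]].
pose phi (z : {ffun H -> H} * (H * H * H)) :=
  (link (link (unlink z.1 z.2.2) z.2.1.1 z.2.2) z.2.1.2 (z.1 z.2.2), z.2.1).
rewrite -[X in X <= _]muln1.
(* The switch yields a simple pairing, and each of its two links joins elements that are free at
   that moment, so that [linkK] can undo it. *)
have facts f a b h : f \in simple_pairings r -> (a, b, h) \in E f ->
    let f0 := unlink f h in let f1 := link f0 a h in
    [/\ simple f, (f0 a = a /\ f0 h = h), (f1 b = b /\ f1 (f h) = f h),
      simple (link f1 b (f h)) & #|free (link f1 b (f h))| = r - 2].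
  rewrite !inE /= => /andP[fs /eqP fr].
  case/and5P=> /eqP fa /eqP fb ab fh /and3P[/and3P[ha hb fhb] nah nbfh].
  have /simpleP[fK fl fm] := fs.
  have ah : a != h by apply: contraNneq ha => ->.
  have bh : b != h by apply: contraNneq hb => ->.
  have afh : a != f h by apply: contraNneq ah => /(congr1 f); rewrite fK fa => ->.
  have bfh : b != f h by apply: contraNneq fhb => ->.
  have f0a : unlink f h a = a by rewrite ffunE (negPf ah) (negPf afh).
  have f0b : unlink f h b = b by rewrite ffunE (negPf bh) (negPf bfh).
  have f0h : unlink f h h = h by rewrite ffunE eqxx.
  have f0fh : unlink f h (f h) = f h by rewrite ffunE eqxx orbT.
  have f1b : link (unlink f h) a h b = b by rewrite ffunE eq_sym (negPf ab) (negPf bh) f0b.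
  have f1fh : link (unlink f h) a h (f h) = f h.
    by rewrite ffunE eq_sym (negPf afh) (negPf fh) f0fh.
  have f0s := simple_unlink h fs.
  have padj0 u v : padj (unlink f h) u v -> padj f u v.
    case/padjP => z [zz <- <-]; apply/padjP; exists z.
    by move: zz; rewrite ffunE; case: ifP => //; rewrite eqxx.
  split=> //.
    apply: simple_link => //; first apply: simple_link => //.
    - by rewrite eq_sym.
    - by apply: contra nah => /padj0.
    - by rewrite eq_sym.
    apply/negP => /padjP[z]; rewrite [link _ a h z]ffunE.
    case: (eqVneq z a) => [-> [_ _ /eqP]|_]; first by rewrite eq_sym (negPf (fl _ fh)).
    case: (eqVneq z h) => [-> [_ /eqP]|_ [zz zb zfh]]; first by rewrite (negPf hb).
    by case/negP: nbfh; apply: padj0; apply/padjP; exists z.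
  rewrite !free_link // free_unlink -fr.
  have aF : a \in free f by rewrite inE fa.
  have bF : b \in free f :\ a by rewrite !inE fb eqxx eq_sym ab.
  rewrite (cardsD1 a (free f)) aF (cardsD1 b (free f :\ a)) bF !add1n subn2 /=.
  congr #|pred_of_set _|; apply/finset.setP => z; rewrite !inE.
  case: (eqVneq z b) => [->|_] /=; first by rewrite andbF.
  case: (eqVneq z a) => [->|_] /=; first by rewrite !andbF.
  case: (eqVneq z (f h)) => [->|_] /=; first by rewrite fK eq_sym (negPf fh).
  by case: (eqVneq z h) => [->|_] //=; rewrite (negPf fh).
apply: (leq_double_count (E := E) (E' := fun _ => finset.setT) (phi := phi)).
- move=> f; rewrite inE => /andP[fs /eqP fr].
  have /simpleP[fK _ _] := fs.
  have /card_gt0P[a aF] : 0 < #|free f| by rewrite fr; apply: leq_trans r2.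
  have /card_gt0P[b] : 0 < #|free f :\ a|.
    by move: r2; rewrite -fr (cardsD1 a) aF.
  rewrite in_setD1 => /andP[ba bF].
  (* At most [3 * d + 2 * (d * d)] half-edges are excluded. A matched half-edge whose partner lies
     at the vertex of [a] is excluded as lying at a neighbor of that vertex. *)
  pose bad := [set h : H | h.1 == a.1] :|: [set h : H | h.1 == b.1]
    :|: (f @^-1: [set h : H | h.1 == b.1]) :|: [set h : H | padj f a.1 h.1]
    :|: (f @^-1: [set h : H | padj f b.1 h.1]).
  have cpre (X : {set H}) : #|f @^-1: X| = #|X|.
    by rewrite on_card_preimset //; exists f => z _; rewrite fK.
  have badD : #|bad| <= 3 * D.
    have leqU (X Y : {set H}) m n : #|X| <= m -> #|Y| <= n -> #|X :|: Y| <= m + n.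
      by move=> Xm Yn; apply: leq_trans (leq_card_setU _ _) _; exact: leq_add.
    apply: (@leq_trans (d + d + d + d * d + d * d)); last by rewrite /D; lia.
    have adjD u : #|[set h : H | padj f u h.1]| <= d * d := card_half_edges_adj f u.
    have atD u : #|[set h : H | h.1 == u]| <= d by rewrite card_half_edges_at.
    apply: (leqU _ _ _ _ _ _); last by rewrite cpre.
    by apply: (leqU _ _ _ _ (leqU _ _ _ _ (leqU _ _ _ _ _ _) _) _); rewrite ?cpre.
  have /card_gt0P[h] : 0 < #|~: free f :\: bad|.
    rewrite cardsD subn_gt0; apply: (@leq_ltn_trans #|bad|).
      exact/subset_leq_card/finset.subsetIr.
    by have := cardsC (free f); rewrite fr card_half_edges; lia.
  rewrite !inE !negb_or -!andbA => /and5P[ha hb fhb nah /andP[nbfh hF]].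
  apply/card_gt0P; exists (a, b, h); rewrite !inE /=.
  move: aF bF; rewrite !inE => -> ->.
  by rewrite eq_sym ba hF ha hb fhb nah nbfh.
- by move=> g _; rewrite cardsT card_prod card_half_edges mulnn.
- move=> f [[a b] h] fP /(facts _ _ _ _ fP)[fs _ _ gs gr].
  by rewrite inE /phi /= gs gr eqxx inE.
- move=> f [[a b] h] f' [[a' b'] h'] fP EP fP' EP' [eq_g eq_a eq_b]; subst a' b'.
  have [/simpleP[fK _ _] [f0a f0h] [f1b f1fh] _ _] := facts _ _ _ _ fP EP.
  have [/simpleP[fK' _ _] [f0a' f0h'] [f1b' f1fh'] _ _] := facts _ _ _ _ fP' EP'.
  (* Decoding in reverse order: the partner of [b] is [f h]; after removing that pair, the partner
     of [a] is [h]; after removing that one, [unlink f h] is left. *)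
  have := congr1 (fun g : {ffun H -> H} => g b) eq_g; rewrite !ffunE eqxx => eq_fh.
  have eq1 := congr1 (fun g => unlink g b) eq_g; rewrite /= !linkK // in eq1.
  have := congr1 (fun g : {ffun H -> H} => g a) eq1; rewrite !ffunE eqxx => eq_h.
  have eq0 := congr1 (fun g => unlink g a) eq1; rewrite /= !linkK // in eq0.
  by rewrite -(unlinkK h fK) -(unlinkK h' fK') eq0 eq_fh eq_h.
Qed.


Lemma simple_pairings_id : [ffun h : H => h] \in simple_pairings N.
Proof.
rewrite inE; apply/andP; split.
  by apply/simpleP; split=> [h|h|h h']; rewrite !ffunE ?eqxx.
rewrite -card_half_edges -cardsT; apply/eqP; congr #|pred_of_set _|.
by apply/finset.setP => h; rewrite !inE ffunE eqxx.
Qed.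

(** [D] equals [d * (d + 1)]; hence for even [N] the greedy phase can stop with exactly [D] free
    half-edges. *)
Let oddD : odd D = false.
Proof. by rewrite /D oddD oddM; case: (odd d). Qed.

Lemma leq_ffact m n k : m <= n -> m ^_ k <= n ^_ k.
Proof.
move=> mn; elim: k m n mn => [|k IHk] [|m] [|n] // mn.
by rewrite !ffactSS leq_mul ?IHk.
Qed.

Lemma ffact_leq_expn n k : n ^_ k <= n ^ k.
Proof.
by rewrite ffact_prod -[in X in _ <= _ ^ X](card_ord k) -prod_nat_const; apply: leq_prod => i _; exact: leq_subr.
Qed.

(** The factor [r + 2 - D] gained by adding an edge is at least [r.+1 * r ^_ D / (r + 2) ^_ D]; in
    this form the product over all steps telescopes. *)
Lemma simple_pairings_step r j : r + 2 * j.+1 = N ->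
  N`! * (r + 2) ^_ D <= #|simple_pairings (r + 2)| * (r + 2)`! * (2 ^ j * j`!) * N ^_ D ->
  N`! * r ^_ D <= #|simple_pairings r| * r`! * (2 ^ j.+1 * (j.+1)`!) * N ^_ D.
Proof.
move=> rN IH; have := simple_pairings_add (r + 2); rewrite addnK.
set A := #|simple_pairings (r + 2)| in IH *; set B := #|simple_pairings r|.
have -> : N - r = 2 * j.+1 by lia.
move=> step; set F := N ^_ D in IH *.
rewrite -(leq_pmul2l (ltn0Sn r)).
have ff : r.+1 * r ^_ D <= (r + 2 - D) * (r + 2) ^_ D.
  rewrite mulnC [X in _ <= X]mulnC -ffactnSr addn2 ffactSS mulnC.
  by apply: leq_mul => //; apply: leq_ffact.
apply: (@leq_trans (N`! * ((r + 2 - D) * (r + 2) ^_ D))).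
  by rewrite mulnCA leq_mul2l ff orbT.
apply: (@leq_trans ((r + 2 - D) * (A * (r + 2)`! * (2 ^ j * j`!) * F))).
  by rewrite mulnCA leq_mul2l IH orbT.
have e1 : (r + 2 - D) * (A * (r + 2)`! * (2 ^ j * j`!) * F)
  = (A * ((r + 2) * (r + 2 - D))) * (r.+1 * r`! * (2 ^ j * j`!) * F).
  by rewrite {2}addn2 !factS addn2; ring.
have e2 : r.+1 * (B * r`! * (2 ^ j.+1 * (j.+1)`!) * F)
  = B * (2 * j.+1) * (r.+1 * r`! * (2 ^ j * j`!) * F).
  by rewrite expnS factS; ring.
by rewrite e1 e2 leq_mul2r step orbT.
Qed.

(** Start from the empty pairing and add [j] edges; [2 ^ j] times the factorial of [j] accounts for
    their orientations and their order. *)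
Lemma simple_pairings_greedy r j : r + 2 * j = N ->
  N`! * r ^_ D <= #|simple_pairings r| * r`! * (2 ^ j * j`!) * N ^_ D.
Proof.
elim: j r => [|j IHj] r rN.
  have -> : r = N by lia.
  rewrite fact0 expn0 !muln1 leq_mul2r; apply/orP; right.
  rewrite -{1}[N`!]mul1n leq_mul2r; apply/orP; right.
  by apply/card_gt0P; exists [ffun h => h]; exact: simple_pairings_id.
apply: simple_pairings_step => //; apply: IHj; lia.
Qed.

(** Each of the [k] final switches costs a factor [N ^ 2], and [4 * D < N] leaves enough matched
    pairs for all of them. *)
Lemma simple_pairings_complete k : 2 * k <= D -> 4 * D < N ->
  #|simple_pairings (2 * k)| <= #|simple_pairings 0| * N ^ (2 * k).
Proof.
move=> kD DN; elim: k kD => [|k IHk] kD; first by rewrite muln0 muln1.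
apply: leq_trans (simple_pairings_switch _ _) _; try lia.
have -> : 2 * k.+1 - 2 = 2 * k by lia.
have -> : 2 * k.+1 = 2 * k + 2 by lia.
by rewrite expnD mulnA leq_mul2r IHk ?orbT //; lia.
Qed.

(** The base on the left is the double factorial of [2 * j], which is at most that of [(2 * j).+1];
    the product of the two is the right-hand side. *)
Lemma double_fact_sqr j : (2 ^ j * j`!) ^ 2 <= (2 * j).+1`!.
Proof.
elim: j => [//|j IHj].
have -> : (2 * j.+1).+1 = (2 * j).+3 by lia.
rewrite (factS (2 * j).+2) (factS (2 * j).+1) (expnS 2 j) (factS j).
have -> : (2 * 2 ^ j * (j.+1 * j`!)) ^ 2 = (2 * j.+1) ^ 2 * (2 ^ j * j`!) ^ 2 by ring.
by rewrite mulnA leq_mul //; nia.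
Qed.

Theorem card_perfect_simple_pairings : ~~ odd N -> 4 * D < N ->
  N`! <= #|simple_pairings 0| ^ 2 * N ^ (4 * D) * N.+1.
Proof.
move=> evN DN.
(* Greedy additions stop at [D] free half-edges, where [r ^_ D] and the factorial of [r] cancel; the
   last [D] half-edges are matched by [k] switches. *)
pose j := (N - D)./2; pose k := D./2.
have kD : 2 * k = D by have := odd_double_half D; rewrite oddD; lia.
have jN : D + 2 * j = N.
  have := odd_double_half (N - D); rewrite -/j oddB ?oddD; last by lia.
  by rewrite (negPf evN) /=; lia.
have := simple_pairings_greedy jN; rewrite ffactnn.
have := double_fact_sqr j; move: (2 ^ j * j`!) => E hE h1; have {h1} : N`! <= #|simple_pairings D| * E * N ^ D.
  rewrite -(leq_pmul2r (fact_gt0 D)); apply: leq_trans h1 _.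
  rewrite -!mulnA leq_mul2l; apply/orP; right.
  rewrite mulnCA leq_mul2l; apply/orP; right.
  by rewrite mulnC leq_mul2r ffact_leq_expn orbT.
have := simple_pairings_complete (eq_leq kD) DN; rewrite kD.
set P0 := #|simple_pairings 0|; set PD := #|simple_pairings D|; move=> hP hN.
have hE' : E ^ 2 <= N.+1`!.
  by apply: leq_trans hE _; apply: leq_fact; rewrite ltnS -jN leq_addl.
have hN2 : N`! <= P0 * N ^ (2 * D) * E.
  apply: leq_trans hN _; rewrite mul2n -addnn expnD.
  apply: (@leq_trans (P0 * N ^ D * E * N ^ D)); last by apply: eq_leq; ring.
  by rewrite !leq_mul2r hP !orbT.
rewrite -(leq_pmul2l (fact_gt0 N)) mulnn.
apply: (@leq_trans ((P0 * N ^ (2 * D) * E) ^ 2)); first by rewrite leq_exp2r.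
have -> : (P0 * N ^ (2 * D) * E) ^ 2 = P0 ^ 2 * N ^ (4 * D) * E ^ 2.
  by rewrite (expnMn _ E) (expnMn P0) -expnM; congr (_ * _ ^ _ * _); ring.
rewrite [X in _ <= X](_ : _ = P0 ^ 2 * N ^ (4 * D) * N.+1`!).
  by rewrite leq_mul2l hE' orbT.
by rewrite factS; ring.
Qed.

End SimplePairings.

(** * Regular graphs as pairings *)

Section GraphOfPairing.
Variables (n d : nat).
Local Notation V := 'I_n.
Local Notation H := (V * 'I_d)%type.
Local Notation perfect := (simple_pairings V d 0).
Implicit Types (f g : {ffun H -> H}) (A : {ffun V * V -> bool}).

Definition pairing_adj f : {ffun V * V -> bool} :=
  [ffun p => [exists i, (f (p.1, i)).1 == p.2]].

Lemma perfectP f :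
  reflect [/\ involutive f, forall h, (f h).1 != h.1 &
              forall u, injective (fun i => (f (u, i)).1)]
          (f \in perfect).
Proof.
rewrite inE cards_eq0; apply: (iffP andP) => [[/simpleP[fK fl fm] /eqP f0]|[fK fl fi]].
  have nf h : f h != h by have := finset.in_set0 h; rewrite -f0 inE => ->.
  by split=> // [h|u i j e]; [exact: fl | have [] := fm (u, i) (u, j) (nf _) (nf _) erefl e].
split.
  apply/simpleP; split=> // -[u i] [v j] _ _ /= <- e.
  by rewrite (fi u i j e).
apply/eqP/finset.setP => h; rewrite !inE; apply: contraNF (fl h) => /eqP ->; exact: eqxx.
Qed.

Lemma regular_axiomP A :
  reflect [/\ forall u, ~~ A (u, u), forall u v, A (u, v) = A (v, u) &
              forall u, #|[set v | A (u, v)]| = d]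
          (regular_graph_axiom d A).
Proof.
apply: (iffP forallP) => [P|[Al As Ad] u].
  by split=> [u|u v|u]; have /and3P[? /forallP Q /eqP ?] := P u => //; exact/eqP/Q.
rewrite Al Ad eqxx andbT /=; apply/forallP => v; exact/eqP/As.
Qed.

Lemma pairing_adj_regular f : f \in perfect -> regular_graph_axiom d (pairing_adj f).
Proof.
case/perfectP => fK fl fi; apply/regular_axiomP; split=> [u|u v|u].
- by rewrite ffunE; apply/existsPn => i; exact: (fl (u, i)).
- rewrite !ffunE /=; suff imp w z : [exists i, (f (w, i)).1 == z] ->
      [exists i, (f (z, i)).1 == w] by apply/idP/idP; exact: imp.
  case/existsP => i /eqP <-; apply/existsP; exists (f (w, i)).2.
  by rewrite -surjective_pairing fK.
- rewrite -[RHS]card_ord -(card_imset _ (fi u)); congr #|pred_of_set _|.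
  apply/finset.setP => v; rewrite inE ffunE /=; apply/existsP/imsetP.
    by case=> i /eqP <-; exists i.
  by case=> i _ ->; exists i.
Qed.

(** A pairing that induces [A] amounts to an independent choice, at each vertex, of a bijection from
    the [d] labels to the [d] neighbors: the label at the far end of an edge is the one pointing
    back. *)
Lemma card_pairings_of_graph A : regular_graph_axiom d A ->
  #|[set f in perfect | pairing_adj f == A]| = d`! ^ n.
Proof.
case/regular_axiomP => Al As Ad.
pose F v := [set g : {ffun 'I_d -> V} in ffun_on (mem [set w | A (v, w)]) | injectiveb g].
have -> : d`! ^ n = #|family F|.
  rewrite card_family foldrE big_map big_enum /=.
  rewrite (eq_bigr (fun=> d`!)) ?prod_nat_const ?card_ord // => v _.
  by rewrite card_inj_ffuns_on card_ord Ad ffactnn.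
have FP v (g : {ffun 'I_d -> V}) : reflect ((forall i, A (v, g i)) /\ injective g) (g \in F v).
  rewrite inE; apply: (iffP andP) => -[h1 h2]; split.
  - by move=> i; have /ffun_onP/(_ i) := h1; rewrite inE.
  - exact/injectiveP.
  - by apply/ffun_onP => i; rewrite inE.
  - exact/injectiveP.
pose L f : {ffun V -> {ffun 'I_d -> V}} := [ffun v => [ffun i => (f (v, i)).1]].
rewrite -(card_in_imset (f := L)); last first.
  move=> f g /setIdP[/perfectP[fK fl fi] _] /setIdP[/perfectP[gK gl gi] _] eL.
  have e1 v i : (f (v, i)).1 = (g (v, i)).1.
    by have /ffunP/(_ v)/ffunP/(_ i) := eL; rewrite !ffunE.
  apply/ffunP => -[v i]; rewrite (surjective_pairing (f _)) (surjective_pairing (g _)) -e1.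
  congr (_, _); apply: (fi (f (v, i)).1).
  by rewrite -surjective_pairing fK (e1 _ (g (v, i)).2) (e1 v i) -surjective_pairing gK.
apply: eq_card => l; apply/imsetP/familyP.
  case=> f /setIdP[/perfectP[fK fl fi] /eqP eA] -> v; rewrite ffunE.
  apply/FP; split=> [i|i j]; rewrite -?eA !ffunE; last exact: fi.
  by apply/existsP; exists i.
move=> lF.
have lA v i : A (v, l v i) by have /FP[] := lF v.
have lI v : injective (l v) by have /FP[] := lF v.
have lS v w : A (v, w) -> exists i, l v i = w.
  move=> vw; suff /imsetP[i _ ->] : w \in l v @: 'I_d by exists i.
  suff -> : l v @: 'I_d = [set w | A (v, w)] by rewrite inE.
  apply/eqP; rewrite eqEcard (card_imset _ (lI v)) Ad card_ord leqnn andbT.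
  by apply/fintype.subsetP => z /imsetP[i _ ->]; rewrite inE.
(* The label at [v] that points to [w]; the default [i0] is never reached when [v] and [w] are
   adjacent. *)
pose nb v w i0 := odflt i0 [pick j | l v j == w].
have nbP v w i0 : A (v, w) -> l v (nb v w i0) = w.
  by case/lS => i lvi; rewrite /nb; case: pickP => [j /eqP //|/(_ i)]; rewrite lvi eqxx.
pose f : {ffun H -> H} := [ffun h => (l h.1 h.2, nb (l h.1 h.2) h.1 h.2)].
have f1 v i : (f (v, i)).1 = l v i by rewrite ffunE.
have As' v i : A (l v i, v) by rewrite As.
exists f; last by apply/ffunP => v; apply/ffunP => i; rewrite !ffunE.
rewrite inE; apply/andP; split.
  apply/perfectP; split=> [[v i]|[v i]|v i j]; last by rewrite !f1; exact: lI.
    rewrite !ffunE /= nbP //; congr (_, _); apply: (lI v); exact: nbP.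
  by rewrite f1 /=; apply/eqP => e; have := lA v i; rewrite e (negPf (Al v)).
apply/eqP/ffunP => -[v w]; rewrite ffunE /=; apply/existsP/idP.
  by case=> i; rewrite f1 => /eqP <-.
by case/lS => i lvi; exists i; rewrite f1 lvi.
Qed.

(** Since all fibers have the same size, proportions of graphs equal proportions of perfect simple
    pairings. *)
Lemma card_pairings_of_graphs (X : {set dgraph d n}) :
  #|[set f in perfect | pairing_adj f \in val @: X]| = #|X| * d`! ^ n.
Proof.
rewrite -sum_nat_const -(eq_bigr _ (fun G _ => card_pairings_of_graph (valP G))).
rewrite -sum1_card (partition_big pairing_adj (mem (val @: X))) /=; last first.
  by move=> f /setIdP[].
rewrite big_imset /=; last by move=> G G' _ _; exact: val_inj.
apply: eq_bigr => G GX; rewrite -sum1_card; apply: eq_bigl => f.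
rewrite !inE -andbA; congr (_ && _); case: eqP => [->|]; rewrite ?andbF // andbT.
by apply/imsetP; exists G.
Qed.

Lemma card_perfect_graphs : #|perfect| = #|{: dgraph d n}| * d`! ^ n.
Proof.
rewrite -cardsT -card_pairings_of_graphs; apply: eq_card => f.
rewrite [RHS]inE; case: (boolP (f \in perfect)) => //= fP; symmetry.
by apply/imsetP; exists (Sub (pairing_adj f) (pairing_adj_regular fP) : dgraph d n); rewrite ?SubK.
Qed.

End GraphOfPairing.

(** * Star types *)

Section StarTypes.
Variables (S : finType) (n d : nat).
Local Notation V := 'I_n.
Local Notation H := (V * 'I_d)%type.
Local Notation T := (S * d.-tuple S)%type.
Local Notation perfect := (simple_pairings V d 0).
Implicit Types (f : {ffun H -> H}) (c : {ffun V -> S}) (tau : {ffun V -> T}).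
Implicit Type k : {ffun T -> 'I_n.+1}.

Definition edge_color (t : T) (i : 'I_d) : S * S := (t.1, tnth t.2 i).

Definition swap (x : S * S) : S * S := (x.2, x.1).

Definition edge_mult (x : S * S) (t : T) := #|[set i | edge_color t i == x]|.

Definition star_types f c : {ffun V -> T} :=
  [ffun v => (c v, [tuple c (f (v, i)).1 | i < d])].

Definition type_count tau : {ffun T -> 'I_n.+1} :=
  [ffun t => inord #|[set v | tau v == t]|].

Lemma type_countE tau t : type_count tau t = #|[set v | tau v == t]| :> nat.
Proof.
rewrite ffunE inordK // ltnS.
by apply: leq_trans (max_card _) _; rewrite card_ord.
Qed.

Definition type_class k : {set {ffun V -> T}} := [set tau | type_count tau == k].

Definition edge_count k (x : S * S) := \sum_t k t * edge_mult x t.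

Lemma swapK : involutive swap. Proof. by case. Qed.

Lemma sum_type_count tau (F : T -> nat) :
  \sum_v F (tau v) = \sum_t type_count tau t * F t.
Proof.
rewrite (partition_big tau predT) //=; apply: eq_bigr => t _.
rewrite (eq_bigr (fun=> F t)) => [|v /eqP -> //].
by rewrite sum_nat_const type_countE; congr (_ * _); apply: eq_card => v; rewrite inE.
Qed.

Lemma color_count_edge tau x :
  color_count (fun h : H => edge_color (tau h.1) h.2) finset.setT x =
  edge_count (type_count tau) x.
Proof.
rewrite /edge_count -(sum_type_count tau (edge_mult x)) /color_count -sum1_card.
rewrite (eq_bigl (fun h : H => predT h.1 && (edge_color (tau h.1) h.2 == x))); last first.
  by move=> h; rewrite !inE.
rewrite -(pair_big_dep predT (fun v i => edge_color (tau v) i == x) (fun _ _ => 1)) /=.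
by apply: eq_bigr => v _; rewrite sum1_card; apply: eq_card => i; rewrite inE.
Qed.

Lemma perfect_color_pairing f c : f \in perfect ->
  f \in color_pairings (fun h : H => edge_color (star_types f c h.1) h.2) swap finset.setT.
Proof.
case/perfectP => fK fl fi; apply/color_pairingsP; split=> // [h _|h]; last by rewrite inE.
split; first by apply: contra (fl h) => /eqP ->.
case: h => v i; rewrite /edge_color /swap !ffunE /= !tnth_mktuple.
by rewrite -surjective_pairing fK.
Qed.

(** Union bound over the star assignments [tau], grouped by their counts; simplicity of the pairings
    is forgotten here. *)
Lemma card_colored_perfect (P : pred {ffun T -> 'I_n.+1}) :
  #|[set f in perfect | [exists c, P (type_count (star_types f c))]]| <=
  \sum_(k | P k) \sum_(tau in type_class k)
     #|color_pairings (fun h : H => edge_color (tau h.1) h.2) swap finset.setT|.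
Proof.
pose X tau := color_pairings (fun h : H => edge_color (tau h.1) h.2) swap finset.setT.
apply: (@leq_trans (\sum_(tau | P (type_count tau)) #|X tau|)).
  apply: (@leq_trans #|\bigcup_(tau | P (type_count tau)) X tau|).
    apply/subset_leq_card/fintype.subsetP => f /finset.setIdP[fP /existsP[c Pc]].
    by apply/finset.bigcupP; exists (star_types f c) => //; exact: perfect_color_pairing.
  elim/big_rec2: _ => [|tau m Y _ IH]; first by rewrite cards0.
  by apply: leq_trans (leq_card_setU _ _) _; rewrite leq_add2l.
rewrite (partition_big type_count P) //=; apply: eq_leq.
apply: eq_bigr => k Pk; apply: eq_bigl => tau; rewrite inE.
by case: eqP => [->|]; rewrite ?Pk ?andbF.
Qed.

(** Pigeonhole over the [n.+1 ^ #|T|] possible count vectors: one of them carries its share of the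
    perfect pairings. Within its class all assignments have the same edge counts, hence the same
    bound on pairings. *)
Lemma exists_large_type_class (P : pred {ffun T -> 'I_n.+1}) : 0 < #|perfect| ->
  #|perfect| <= 2 * #|[set f in perfect | [exists c, P (type_count (star_types f c))]]| ->
  exists2 k, P k &
    #|perfect| ^ 2 <=
    (2 * n.+1 ^ #|{: T}| * #|type_class k|) ^ 2 * \prod_x (edge_count k x)`!.
Proof.
move=> p0 /leq_trans/(_ (leq_mul (leqnn 2) (card_colored_perfect P))).
pose X k := \sum_(tau in type_class k)
     #|color_pairings (fun h : H => edge_color (tau h.1) h.2) swap finset.setT|.
rewrite -/(X _) => pX.
have [k Pk pk] : exists2 k, P k & #|perfect| <= 2 * n.+1 ^ #|{: T}| * X k.
  apply/exists_inP; apply: contraLR pX => /exists_inPn small; rewrite -ltnNge.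
  rewrite -(ltn_pmul2l (_ : 0 < n.+1 ^ #|{: T}|)) ?expn_gt0 //.
  have cK : #|{: {ffun T -> 'I_n.+1}}| = n.+1 ^ #|{: T}| by rewrite card_ffun card_ord.
  rewrite mulnCA mulnA big_distrr /=.
  apply: (@leq_ltn_trans (\sum_(k : {ffun T -> 'I_n.+1}) #|perfect|.-1)).
    rewrite big_mkcond /=; apply: leq_sum => k _; case: ifP => // Pk.
    by have := small k Pk; rewrite -ltnNge; case: #|perfect| p0.
  by rewrite sum_nat_const cK ltn_pmul2l ?expn_gt0 // prednK.
exists k => //; apply: (@leq_trans ((2 * n.+1 ^ #|{: T}| * X k) ^ 2)).
  by rewrite leq_exp2r.
rewrite expnMn [X in _ <= X * _]expnMn -mulnA leq_mul2l; apply/orP; right.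
apply: sum_sqr_le => tau; rewrite inE => /eqP <-.
apply: leq_trans (card_color_pairings _ swapK _) _.
by apply: eq_leq; apply: eq_bigr => x _; rewrite color_count_edge.
Qed.

End StarTypes.

(** * The first moment bound *)

Local Open Scope ring_scope.

(** * Averaging over the classes of an equivalence relation *)

Section Symmetrize.
Variables (R : realType) (T : finType) (E : rel T).
Hypothesis E_refl : reflexive E.
Hypothesis E_eq : forall x y, E x y -> E x =1 E y.
Implicit Types (k : T -> R) (phi : T -> R).

Definition symmetrize k (t : T) : R := (\sum_(t' | E t t') k t') / #|E t|%:R.

Lemma class_sym x y : E x y = E y x.
Proof. by apply/idP/idP => /E_eq <-. Qed.

Lemma card_class_gt0 t : (0 < #|E t|)%N.
Proof. by apply/card_gt0P; exists t; exact: E_refl. Qed.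

Lemma symmetrize_invariant k t t' : E t t' -> symmetrize k t = symmetrize k t'.
Proof.
move=> /E_eq tt'; rewrite /symmetrize (eq_card tt'); congr (_ / _).
exact: eq_bigl.
Qed.

Lemma symmetrize_ge0 k t : (forall t, 0 <= k t) -> 0 <= symmetrize k t.
Proof. by move=> k0; rewrite divr_ge0 // sumr_ge0. Qed.

Lemma symmetrize_gt0 k t : (forall t, 0 <= k t) -> 0 < k t -> 0 < symmetrize k t.
Proof.
move=> k0 kt; rewrite divr_gt0 ?ltr0n ?card_class_gt0 // (bigD1 t) ?E_refl //=.
by rewrite ltr_wpDr // sumr_ge0.
Qed.

(** Averaging is self-adjoint and fixes the functions that are constant on classes. *)
Lemma sum_symmetrize k phi : (forall t t', E t t' -> phi t = phi t') ->
  \sum_t symmetrize k t * phi t = \sum_t k t * phi t.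
Proof.
move=> phiE.
under eq_bigr do rewrite /symmetrize -mulrA big_distrl /=.
rewrite (exchange_big_dep predT) //=; apply: eq_bigr => t _.
rewrite (eq_bigr (fun=> k t * (#|E t|%:R^-1 * phi t))) => [|t' t't]; last first.
  by rewrite (phiE _ _ t't) (eq_card (E_eq t't)).
rewrite sumr_const -(eq_card (_ : E t =1 [pred i | E i t])); last first.
  by move=> t'; rewrite /= class_sym.
rewrite -mulrnAr -mulrnAl -[_ *+ _]mulr_natl divff ?mul1r //.
by rewrite pnatr_eq0 -lt0n card_class_gt0.
Qed.

End Symmetrize.

(** * Entropy bound on the size of a type class *)

Section TypeClassBound.
Variables (R : realType) (T V : finType) (E : rel T).
Hypothesis E_refl : reflexive E.
Hypothesis E_eq : forall x y, E x y -> E x =1 E y.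

(* The weight [tau |-> \prod_v w (tau v)] has total mass [#|V| ^ #|V|] and is
   constant on the type class. *)
Lemma type_class_le (k : T -> nat) (X : {set {ffun V -> T}}) :
  (forall tau, tau \in X -> forall t, #|[set v | tau v == t]| = k t) ->
  let w := symmetrize E (fun t => (k t)%:R : R) in
  X != finset.set0 ->
  #|X|%:R * expR (\sum_t w t * ln (w t)) <= #|V|%:R ^+ #|V|.
Proof.
move=> kX w /finset.set0Pn[tau0 tau0X].
have w0 t : 0 <= w t by apply: symmetrize_ge0.
have sumE tau (F : T -> R) : tau \in X -> \sum_v F (tau v) = \sum_t (k t)%:R * F t.
  move=> tauX; rewrite (partition_big tau predT) //=; apply: eq_bigr => t _.
  rewrite (eq_bigr (fun=> F t)) => [|v /eqP -> //].
  by rewrite sumr_const -(kX _ tauX) mulr_natl; congr (_ *+ _); apply: eq_card => v; rewrite inE.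
have sum_w : \sum_t w t = #|V|%:R.
  have := sum_symmetrize E_refl E_eq (fun t => (k t)%:R : R) (phi := fun=> 1) (fun _ _ _ => erefl).
  under eq_bigr do rewrite mulr1; move=> ->.
  by rewrite -(sumE tau0 (fun=> 1)) // sumr_const.
(* [ln w] is constant on the classes of [E], so summing it against the counts [k] or against their
   average [w] gives the same value. *)
have prod_w tau : tau \in X -> \prod_v w (tau v) = expR (\sum_t w t * ln (w t)).
  move=> tauX; rewrite (sum_symmetrize E_refl E_eq) => [|t t' tt']; last first.
    by congr ln; exact: symmetrize_invariant.
  rewrite -(sumE tau) // expR_sum; apply: eq_bigr => v _; rewrite lnK //.
  rewrite posrE; apply: symmetrize_gt0 => //; rewrite ltr0n -(kX _ tauX).
  by apply/card_gt0P; exists v; rewrite inE.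
rewrite -sum_w -prodr_const bigA_distr_bigA /= [leRHS](bigID (mem X)) /=.
rewrite (eq_bigr _ prod_w) sumr_const mulr_natl ler_wpDr // sumr_ge0 // => tau _.
exact: prodr_ge0.
Qed.

End TypeClassBound.

(** * Elementary Stirling bounds *)

Section Stirling.
Variable R : realType.

(** Both bounds are [ln (1 + x) <= x], at [x = - 1 / (n + 1)] and at [x = 1 / n]. *)
Lemma ln_succ_bounds (n : nat) : (0 < n)%N ->
  n.+1%:R^-1 <= ln (n.+1%:R : R) - ln (n%:R) <= n%:R^-1.
Proof.
move=> n0; have n0' : 0 < n%:R :> R by rewrite ltr0n.
have n1' : 0 < n.+1%:R :> R by rewrite ltr0n.
rewrite -ln_div ?posrE //; apply/andP; split.
  rewrite -[X in _ <= X]opprK -lnV ?posrE ?divr_gt0 // invf_div lerNr.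
  have -> : n%:R / n.+1%:R = 1 + (- n.+1%:R^-1) :> R.
    by apply: (mulIf (lt0r_neq0 n1')); rewrite divfK ?lt0r_neq0 // mulrDl mul1r mulNr mulVf ?lt0r_neq0 // -natr1 addrK.
  by apply: le_ln1Dx; rewrite ltrN2 invf_lt1 // ltr1n ltnS.
have -> : n.+1%:R / n%:R = 1 + n%:R^-1 :> R.
  by rewrite -natr1 mulrDl divff ?lt0r_neq0 // mul1r.
by apply: le_ln1Dx; apply: lt_le_trans (ltrN10 _) _; rewrite invr_ge0 ltW.
Qed.

(** Induction from [n = 1], with the two halves of [ln_succ_bounds] cleared of denominators; the
    case [n = 0] relies on [ln 0 = 0]. *)
Lemma ln_fact_bounds (n : nat) :
  n%:R * ln n%:R - n%:R <= ln (n`!%:R : R) <= n%:R * ln n%:R - n%:R + ln n%:R + 1.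
Proof.
case: n => [|n]; first by rewrite fact0 ln1 mul0r subr0 ln0 // !add0r lexx ler01.
elim: n => [|n /andP[IH1 IH2]]; first by rewrite (_ : 1`! = 1%N) // ln1; lra.
have m0 : 0 < n.+1%:R :> R by rewrite ltr0n.
have m1 : 0 < n.+2%:R :> R by rewrite ltr0n.
have /andP[h1 h2] := ln_succ_bounds (ltn0Sn n).
rewrite -(ler_pM2l m1) divff ?lt0r_neq0 // in h1.
rewrite -(ler_pM2l m0) divff ?lt0r_neq0 // in h2.
rewrite factS natrM lnM ?posrE ?ltr0n ?fact_gt0 //.
have e : n.+2%:R = n.+1%:R + 1 :> R by rewrite natr1.
set a : R := ln n.+2%:R in h1 h2 *; set b : R := ln n.+1%:R in h1 h2 IH1 IH2 *.
move: (ln _) IH1 IH2 => L; rewrite e in h1 *.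
by move: (n.+1%:R : R) a b h1 h2 {m0 m1 e} => m a b h1 h2 IH1 IH2; apply/andP; split; lra.
Qed.

End Stirling.

(** * The entropy inequality for a single graph size, with explicit error *)

Section FirstMoment.
Variables (R : realType) (S : finType) (d : nat).
Local Notation T := (S * d.-tuple S)%type.

Definition star_eq : rel T := fun t t' => (t.1 == t'.1) && perm_eq t.2 t'.2.

Lemma star_eq_refl : reflexive star_eq.
Proof. by move=> t; rewrite /star_eq eqxx perm_refl. Qed.

Lemma star_eq_class t t' : star_eq t t' -> star_eq t =1 star_eq t'.
Proof. by case/andP => /eqP e /permPl p x; rewrite /star_eq e p. Qed.

Lemma edge_mult_star_eq x t t' : star_eq t t' -> edge_mult x t = edge_mult x t'.
Proof.
have E (s : T) : edge_mult x s = ((s.1 == x.1) * count_mem x.2 s.2)%N.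
  rewrite /edge_mult /edge_color -sum1dep_card [LHS]big_mkcond /=.
  rewrite -sum1_count [X in (_ * X)%N]big_mkcond big_tuple big_distrr /=; apply: eq_bigr => i _.
  by rewrite -pair_eqE /=; case: (_ == _); case: (_ == _).
by case/andP => /eqP e /seq.permP p; rewrite !E e p.
Qed.

(** The law of the color pair along a uniformly chosen leaf of a star, when [u] is the law of the
    star. *)
Definition edge_law (u : T -> R) (x : S * S) : R :=
  d%:R^-1 * \sum_t u t * (edge_mult x t)%:R.

(* A rooted ball shows a star only up to a permutation of its leaves, so the
   frequencies of labelled stars are averaged over these permutations. *)
Definition type_freq n (k : {ffun T -> 'I_n.+1}) (t : T) : R :=
  symmetrize star_eq (fun t => (k t)%:R) t / n%:R.

Lemma sum_edge_mult (t : T) : (\sum_x edge_mult x t)%N = d.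
Proof.
rewrite -[RHS]card_ord -sum1_card (partition_big (edge_color t) predT) //=.
by apply: eq_bigr => x _; rewrite sum1dep_card.
Qed.

Lemma entropy_scale (I : finType) (w : I -> R) (s : R) :
  0 < s -> (forall i, 0 <= w i) -> \sum_i w i = s ->
  s * entropy (fun i => w i / s) = s * ln s - \sum_i w i * ln (w i).
Proof.
move=> s0 w0 sw; have -> : s * ln s = \sum_i w i * ln s by rewrite -mulr_suml sw.
rewrite /entropy mulrN mulr_sumr -sumrB -sumrN.
apply: eq_bigr => i _; have s0' := lt0r_neq0 s0.
rewrite mulrA [s * _]mulrC divfK //.
have [->|wi] := eqVneq (w i) 0; first by rewrite !mul0r subrr oppr0.
have wp : w i \is Num.pos by rewrite posrE lt_def wi w0.
by rewrite ln_div //= mulrBr opprB.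
Qed.

Lemma ler_ln_nat (m n : nat) : (m <= n)%N -> ln (m%:R : R) <= ln (n.+1%:R).
Proof.
case: m => [|m] mn; first by rewrite ln0 // ln_ge0 // ler1n.
by rewrite ler_ln ?posrE ?ltr0n // ler_nat ltnW.
Qed.

(** Take logarithms of the hypothesis and of [card_perfect_simple_pairings]. The linear terms of
    Stirling's bounds cancel because the edge counts add up to [n * d]; the last term collects the
    constants and the multiples of a logarithm. *)
Lemma first_moment_bound n (k : {ffun T -> 'I_n.+1}) :
  (0 < n)%N -> (0 < d)%N -> ~~ odd (n * d) -> (4 * (d + d * d) < n * d)%N ->
  (#|simple_pairings 'I_n d 0| ^ 2 <=
    (2 * n.+1 ^ #|{: T}| * #|type_class k|) ^ 2 * \prod_x (edge_count k x)`!)%N ->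
  (n * d)%:R * entropy (edge_law (type_freq k)) <=
    2 * (n%:R * entropy (type_freq k)) +
    (ln 4 + #|{: S * S}|%:R + (2 * #|{: T}| + #|{: S * S}| + 4 * (d + d * d) + 1)%:R * ln (n * d).+1%:R).
Proof.
move=> n0 d0 + + kP; have [N NE] : {N | N = (n * d)%N} by exists (n * d)%N.
rewrite -NE => evN largeN.
set w := symmetrize star_eq (fun t => (k t)%:R : R).
have N0 : (0 < N)%N by rewrite NE muln_gt0 n0.
have := @card_perfect_simple_pairings 'I_n d; rewrite card_ord -NE => /(_ evN largeN) hN.
(* An empty class would leave no perfect simple pairing, contrary to their lower bound. *)
have Y0 : (0 < #|type_class k|)%N.
  rewrite lt0n; apply/eqP => Y0; move: kP hN.
  by rewrite Y0 muln0 exp0n // mul0n leqn0 => /eqP ->; rewrite !mul0n leqNgt fact_gt0.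
have w0 t : 0 <= w t by apply: symmetrize_ge0.
have kE tau : tau \in type_class k -> forall t, #|[set v | tau v == t]| = k t.
  by rewrite inE => /eqP <- t; rewrite type_countE.
have sum_k : (\sum_t (k t : nat))%N = n.
  have /card_gt0P[tau] := Y0; rewrite inE => /eqP <-.
  have := sum_type_count tau (fun=> 1%N); under [RHS]eq_bigr do rewrite muln1.
  by move=> <-; rewrite sum1_card card_ord.
have sum_w : \sum_t w t = n%:R.
  have := sum_symmetrize star_eq_refl star_eq_class (fun t => (k t)%:R : R) (phi := fun=> 1) (fun _ _ _ => erefl).
  by under eq_bigr do rewrite mulr1; move=> ->; under eq_bigr do rewrite mulr1; rewrite -natr_sum sum_k.
have Ybound : ln #|type_class k|%:R <= n%:R * ln n%:R - \sum_t w t * ln (w t).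
  have := type_class_le R star_eq_refl star_eq_class kE; rewrite -/w card_ord.
  have -> : type_class k != finset.set0 by rewrite -card_gt0.
  move=> /(_ isT) h.
  rewrite lerBrDr -[X in _ + X]expRK -lnM ?posrE ?ltr0n ?expR_gt0 //.
  rewrite (mulr_natl (ln n%:R)) -lnXn ?ltr0n // ler_ln ?posrE ?exprn_gt0 ?ltr0n //.
  by rewrite mulr_gt0 ?ltr0n ?expR_gt0.
(* Edge multiplicities ignore the order of the leaves, so averaging leaves the edge counts
   unchanged. *)
have edgeE x : (edge_count k x)%:R = \sum_t w t * (edge_mult x t)%:R.
  rewrite (sum_symmetrize star_eq_refl star_eq_class) => [|t t' /(edge_mult_star_eq x) -> //].
  by rewrite natr_sum; apply: eq_bigr => t _; rewrite natrM.
have sum_edge : (\sum_x edge_count k x)%N = N.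
  rewrite exchange_big /=; under eq_bigr do rewrite -big_distrr /= sum_edge_mult.
  by rewrite -big_distrl /= sum_k NE.
have -> : N%:R * entropy (edge_law (type_freq k)) =
    N%:R * ln N%:R - \sum_x (edge_count k x)%:R * ln (edge_count k x)%:R.
  rewrite -entropy_scale ?ltr0n // -?natr_sum ?sum_edge //.
  congr (_ * entropy _); apply/funext => x.
  rewrite /edge_law edgeE NE natrM invfM mulrA mulrC; congr (_ * _).
  by rewrite mulr_suml; apply: eq_bigr => t _; rewrite /type_freq mulrAC.
have -> : n%:R * entropy (type_freq k) = n%:R * ln n%:R - \sum_t w t * ln (w t).
  by rewrite -entropy_scale ?ltr0n.
have /andP[lowN _] := ln_fact_bounds R N.
have upm x : ln ((edge_count k x)`!%:R : R) <= (edge_count k x)%:R * ln (edge_count k x)%:R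
    - (edge_count k x)%:R + ln N.+1%:R + 1.
  have /andP[_ h] := ln_fact_bounds R (edge_count k x); apply: le_trans h _.
  rewrite lerD2r lerD2l; apply: ler_ln_nat.
  by rewrite -sum_edge (bigD1 x) //= leq_addr.
have lnN : ln (N`!%:R : R) <= ln 4 + (2 * #|{: T}|)%:R * ln n.+1%:R + 2 * ln #|type_class k|%:R
    + \sum_x ln (edge_count k x)`!%:R + (4 * (d + d * d))%:R * ln N%:R + ln N.+1%:R.
  have pos (m : nat) : (0 < m)%N -> (m%:R : R) \is Num.pos by rewrite posrE ltr0n.
  have [] : 0 < (\prod_x (edge_count k x)`!)%N%:R :> R /\
      ln ((\prod_x (edge_count k x)`!)%N%:R : R) = \sum_x ln (edge_count k x)`!%:R.
    rewrite natr_prod; apply: (big_ind2 (fun a b : R => 0 < a /\ ln a = b)).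
    - by rewrite ln1 ltr01.
    - by move=> a b a' b' [a0 <-] [a'0 <-]; rewrite lnM ?mulr_gt0.
    - by move=> x _; rewrite ltr0n fact_gt0.
  rewrite ltr0n; set M := (\prod_x _)%N => M0 <-.
  have hle : (N`! <= (2 * n.+1 ^ #|{: T}| * #|type_class k|) ^ 2 * M * N ^ (4 * (d + d * d)) * N.+1)%N.
    by apply: leq_trans hN _; rewrite !leq_mul2r kP !orbT.
  have A0 : (0 < 2 * n.+1 ^ #|{: T}| * #|type_class k|)%N by rewrite !muln_gt0 expn_gt0 Y0.
  apply: (@le_trans _ _ (ln ((2 * n.+1 ^ #|{: T}| * #|type_class k|) ^ 2 * M * N ^ (4 * (d + d * d)) * N.+1)%N%:R)).
    by rewrite ler_ln ?pos ?ler_nat // ?fact_gt0 // !(expn_gt0, muln_gt0, N0, M0, Y0).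
  rewrite !natrM !natrX.
  rewrite (lnM (x := _ * _)) /= ?(lnXn, lnM) ?posrE ?mulr_gt0 ?exprn_gt0 ?ltr0n //=.
  have -> : ln 4 = 2 * ln 2 :> R.
    by rewrite (_ : 4 = 2 * 2) ?lnM ?posrE //=; lra.
  by rewrite -[ln n.+1%:R *+ _]mulr_natl -[ln N%:R *+ _]mulr_natl natrM; lra.
have lnn : ln n.+1%:R <= ln N.+1%:R :> R.
  by rewrite ler_ln ?posrE ?ltr0n // ler_nat ltnS NE leq_pmulr.
have lnN1 : ln N%:R <= ln N.+1%:R :> R by exact: ler_ln_nat.
have : \sum_x ln ((edge_count k x)`!%:R : R) <= \sum_x ((edge_count k x)%:R *
    ln (edge_count k x)%:R - (edge_count k x)%:R + ln N.+1%:R + 1).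
  by apply: ler_sum => x _; exact: upm.
rewrite 2!big_split /= sumrB !sumr_const -natr_sum sum_edge -[ln _ *+ _]mulr_natl.
have := ler_wpM2l (ler0n R (2 * #|{: T}|)) lnn.
have := ler_wpM2l (ler0n R (4 * (d + d * d))) lnN1.
rewrite !natrD.
move: lnN lowN Ybound; lra.
Qed.

End FirstMoment.

(** * Sublinearity of the error and continuity of entropy *)

Section Asymptotics.
Variable R : realType.

Lemma ln_affine_le (C0 C1 eta : R) (d : nat) : 0 <= C1 -> 0 < eta -> (0 < d)%N ->
  exists n0 : nat, forall n, (n0 <= n)%N -> C0 + C1 * ln (n * d).+1%:R <= eta * n%:R.
Proof.
move=> C10 eta0 d0; have d0' : 0 < d%:R :> R by rewrite ltr0n.
(* The slope is chosen so that [ln x <= D * x - ln D] costs at most [eta / 2] per vertex; the other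
   half of [eta] absorbs the constant [K]. *)
set D := eta / (2 * d%:R * (C1 + 1)).
have C11 : 0 < C1 + 1 by lra.
have D0 : 0 < D by rewrite divr_gt0 // !mulr_gt0.
have DE : D * d%:R * (C1 + 1) = eta / 2.
  by rewrite /D; field; rewrite !lt0r_neq0.
set K := C0 + C1 * (D - ln D).
exists (Num.bound `|2 * K / eta|) => n n_large.
have Kn : K <= eta / 2 * n%:R.
  have h : 2 * K / eta <= n%:R.
    apply: le_trans (ler_norm _) _; apply: ltW.
    by apply: lt_le_trans (archi_boundP (normr_ge0 _)) _; rewrite ler_nat.
  by rewrite ler_pdivrMr // in h; lra.
have x0 : 0 < (n * d).+1%:R :> R by rewrite ltr0n.
have lnx : ln (n * d).+1%:R <= D * (n%:R * d%:R + 1) - ln D.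
  rewrite lerBrDr -lnM ?posrE // mulrC -natrM natr1.
  by apply: ltW; apply: ln_sublinear; rewrite mulr_gt0.
apply: (@le_trans _ _ (K + C1 * (D * d%:R) * n%:R)).
  have := ler_wpM2l C10 lnx; rewrite /K; lra.
have n0 : 0 <= n%:R :> R by [].
have : C1 * (D * d%:R) <= eta / 2 by rewrite -DE; have := mulr_gt0 D0 d0'; lra.
by move=> /(ler_wpM2r n0); lra.
Qed.

Lemma xlnx_continuous : continuous (fun x : R => x * ln x).
Proof.
move=> p; have [p0|p0|->] := ltgtP p 0.
- rewrite /continuous_at ln0 ?ltW // mulr0.
  apply: cvg_near_cst; near=> x; rewrite ln0 ?mulr0 //.
  by apply: ltW; near: x; exact: lt_nbhsl.
- by apply: cvgM; [exact: cvg_id | exact: continuous_ln].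
(* At 0 with [x > 0], let [s] be the square root of [x]. Then [x * ln x] is [2 * s * (s * ln s)],
   and [- ln s <= 1 / s] bounds the inner factor by 1 in absolute value for [x <= 1]. *)
rewrite /continuous_at mul0r; apply/cvgr0Pnorm_le => e e0.
have n1 : \forall x \near (0 : R), x <= 1 by apply: lt_le_nbhsl; exact: ltr01.
have ne : \forall x \near (0 : R), x <= (e / 2) ^+ 2.
  by apply: lt_le_nbhsl; rewrite exprn_gt0 ?divr_gt0.
near=> x; have [x0|x0] := leP x 0; first by rewrite (ln0 x0) mulr0 normr0 ltW.
have x1 : x <= 1 by near: x; exact: n1.
have xe : x <= (e / 2) ^+ 2 by near: x; exact: ne.
have s0 : 0 < Num.sqrt x by rewrite sqrtr_gt0.
have sx : x = Num.sqrt x * Num.sqrt x by rewrite -expr2 sqr_sqrtr ?(ltW x0).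
rewrite ler0_norm ?mulr_ge0_le0 ?ln_le0 ?(ltW x0) //.
have lns : - ln (Num.sqrt x) <= (Num.sqrt x)^-1.
  by rewrite -lnV ?posrE //; apply/ltW/ln_sublinear; rewrite invr_gt0.
have : Num.sqrt x <= e / 2.
  rewrite -(@ler_pXn2r _ 2) ?nnegrE ?sqrtr_ge0 ?divr_ge0 ?(ltW e0) //.
  by rewrite sqr_sqrtr ?(ltW x0).
have lnx : ln x = ln (Num.sqrt x) + ln (Num.sqrt x) by rewrite {1}sx lnM ?posrE.
have h : Num.sqrt x * - ln (Num.sqrt x) <= 1.
  by have := ler_wpM2l (ltW s0) lns; rewrite divff ?lt0r_neq0.
have := ler_wpM2l (ltW s0) h.
have -> : x * ln x = - (2 * (Num.sqrt x * (Num.sqrt x * - ln (Num.sqrt x)))).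
  by rewrite lnx {1}sx; ring.
lra.
Unshelve. all: by end_near.
Qed.

Lemma cvg_entropy (I : finType) (u : nat -> I -> R) (p : I -> R) :
  (forall i, (u j i @[j --> \oo] --> p i)%classic) ->
  (entropy (u j) @[j --> \oo] --> entropy p)%classic.
Proof.
move=> up; apply: cvgN; apply: cvg_big => [|i _]; first exact: add_continuous.
exact: (continuous_cvg _ (xlnx_continuous (x := p i))).
Qed.

End Asymptotics.

(** * Passage to the limit in the entropy inequality *)

Section FirstMomentLimit.
Variables (R : realType) (S : finType) (d : nat).
Local Notation T := (S * d.-tuple S)%type.

Definition near_pairings n (p : T -> R) (eps : R) :=
  [set f in simple_pairings 'I_n d 0 | [exists c,
     [forall t, `|type_freq R (type_count (star_types f c)) t - p t| <= eps]]].

Lemma first_moment_step (eta : R) : (0 < d)%N -> 0 < eta ->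
  exists n0 : nat, forall n (p : T -> R) eps, (n0 <= n)%N -> ~~ odd (n * d) ->
    (#|simple_pairings 'I_n d 0| <= 2 * #|near_pairings n p eps|)%N ->
    exists2 u : T -> R, (forall t, `|u t - p t| <= eps) &
      d%:R * entropy (edge_law u) <= 2 * entropy u + eta.
Proof.
move=> d0 eta0.
have [n1 n1P] := ln_affine_le (ln 4 + #|{: S * S}|%:R)
  (ler0n R (2 * #|{: T}| + #|{: S * S}| + 4 * (d + d * d) + 1)) eta0 d0.
(* Beyond [n1] the error is at most [eta * n]; the other bound provides the room needed for the
   greedy matching. *)
exists (maxn n1 (4 * (d + d * d)).+1) => n p eps; rewrite geq_max => /andP[nn1 nd] evN near.
have n0 : (0 < n)%N by apply: leq_trans nd.
have largeN : (4 * (d + d * d) < n * d)%N by apply: leq_trans nd _; rewrite leq_pmulr.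
have perf0 : (0 < #|simple_pairings 'I_n d 0|)%N.
  have := @card_perfect_simple_pairings 'I_n d; rewrite card_ord => /(_ evN largeN).
  by rewrite !lt0n; apply: contraL => /eqP ->; rewrite exp0n // !mul0n -ltnNge fact_gt0.
pose P (k : {ffun T -> 'I_n.+1}) := [forall t, `|type_freq R k t - p t| <= eps].
have [k /forallP Pk kP] := exists_large_type_class (P := P) perf0 near.
exists (type_freq R k) => //.
have := first_moment_bound R n0 d0 evN largeN kP.
move=> /le_trans/(_ (lerD (lexx _) (n1P n nn1))).
have n0' : 0 < n%:R :> R by rewrite ltr0n.
rewrite natrM => h; rewrite -(ler_pM2l n0'); lra.
Qed.

Lemma first_moment_limit (p : T -> R) : (0 < d)%N ->
  (forall (eps : R) (j : nat), 0 < eps -> exists n, [/\ (j <= n)%N, ~~ odd (n * d) &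
     (#|simple_pairings 'I_n d 0| <= 2 * #|near_pairings n p eps|)%N]) ->
  d%:R * entropy (edge_law p) <= 2 * entropy p.
Proof.
move=> d0 freq.
(* [harmonic j] serves both as the distance to [p] and as the slack in the inequality. *)
have /choice[u uP] (j : nat) : exists u : T -> R, (forall t, `|u t - p t| <= harmonic j) /\
    d%:R * entropy (edge_law u) <= 2 * entropy u + harmonic j.
  have h0 : 0 < harmonic j :> R by rewrite invr_gt0.
  have [n0 n0P] := first_moment_step d0 h0.
  have [n [n0n ev near]] := freq (harmonic j) n0 h0.
  by have [u ? ?] := n0P n p _ n0n ev near; exists u.
have up t : (u j t @[j --> \oo] --> p t)%classic.
  apply/cvgrPdist_le => e e0; have /cvgrPdist_le/(_ e e0) := @cvg_harmonic R.
  apply: filterS => j; rewrite sub0r normrN distrC.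
  by apply: le_trans; apply: le_trans (proj1 (uP j) t) _; exact: ler_norm.
have edge_up x : (edge_law (u j) x @[j --> \oo] --> edge_law p x)%classic.
  apply: cvgMr; apply: cvg_big => [|t _]; first exact: add_continuous.
  by apply: cvgMl; exact: up.
rewrite -[X in _ <= X]addr0.
apply: (@ler_cvg_to _ \oo%classic _ R (fun j => d%:R * entropy (edge_law (u j)))
  (fun j => 2 * entropy (u j) + harmonic j)).
- by apply: cvgMr; exact: cvg_entropy.
- by apply: cvgD; [apply: cvgMr; exact: cvg_entropy | exact: cvg_harmonic].
- by near=> j; exact: (proj2 (uP j)).
Unshelve. all: by end_near.
Qed.

End FirstMomentLimit.

(** * The tree and its local statistics *)

Section TreeAutomorphisms.
Variable d : nat.
Implicit Types (o u v : tree d) (s : seq 'I_d).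

Definition word_act s v : tree d := foldr (fun i w => nbr w i) v s.

Lemma word_actK s v : word_act (rev s) (word_act s v) = v.
Proof.
elim: s v => [//|i s IHs] v; rewrite rev_cons -cats1 /word_act foldr_cat /= nbrK.
exact: IHs.
Qed.

Lemma word_act_root v : word_act (val v) (tree_root d) = v.
Proof.
case: v => s; elim: s => [|i s IHs] rs; first exact/val_inj.
rewrite /= (IHs (path_sorted rs)); apply/val_inj => /=.
by case: s rs {IHs} => [//|j s] /= /andP[/negPf ->].
Qed.

(** Edges of the Cayley graph come from left multiplication by generators, and this map is right
    multiplication by [o]; hence the two commute. *)
Definition translate o v : tree d := word_act (val v) o.

Lemma translate_root o : translate o (tree_root d) = o.
Proof. by []. Qed.

Lemma translate_nbr o v i : translate o (nbr v i) = nbr (translate o v) i.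
Proof.
case: v => -[|j s] rs //=; rewrite /translate /=.
by case: eqVneq => [->|_] //=; rewrite nbrK.
Qed.

Lemma translate_act o s v : translate o (word_act s v) = word_act s (translate o v).
Proof. by elim: s => [//|i s IHs] /=; rewrite translate_nbr IHs. Qed.

Lemma translate_bij o : bijective (translate o).
Proof.
(* The generators are involutions, so the reversed word represents the inverse of [o]. *)
pose o' := word_act (rev (val o)) (tree_root d).
have oo' : translate o o' = tree_root d.
  by rewrite translate_act translate_root -{2}(word_act_root o) word_actK.
have o'o : translate o' o = tree_root d.
  rewrite -{1}(word_act_root o) translate_act translate_root.
  by rewrite -{1}(revK (val o)) word_actK.
by exists (translate o') => v; rewrite /translate -/(translate _ _) translate_act ?oo' ?o'o word_act_root.
Qed.

Lemma translate_aut o : tree_aut (translate o).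
Proof.
split; first exact: translate_bij.
move=> u v; apply: eq_existsb => i.
by rewrite -translate_nbr (inj_eq (bij_inj (translate_bij o))).
Qed.

Lemma map_reduced (pi : {perm 'I_d}) s : reduced s -> reduced (map pi s).
Proof.
rewrite /reduced sorted_map; apply: sub_sorted => i j /=.
by rewrite (inj_eq perm_inj).
Qed.

(** The group automorphism that permutes the generators; it fixes the root and permutes its
    neighbors by [pi]. *)
Definition relabel (pi : {perm 'I_d}) v : tree d :=
  exist (fun w => reduced w) _ (map_reduced pi (valP v)).

Lemma relabel_nbr pi v i : relabel pi (nbr v i) = nbr (relabel pi v) (pi i).
Proof.
apply/val_inj; case: v => -[|j s] rs //=.
by rewrite (inj_eq perm_inj); case: eqVneq.
Qed.

Lemma relabel_aut pi : tree_aut (relabel pi).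
Proof.
have inj : injective (relabel pi).
  by move=> u v /(congr1 val) /= /(inj_map perm_inj) /val_inj.
split.
  by exists (relabel pi^-1) => v; apply/val_inj => /=;
     rewrite -map_comp map_id_in // => i _ /=; rewrite ?permK ?permKV.
move=> u v; apply/existsP/existsP => -[i /eqP e].
  by exists (pi^-1 i)%g; rewrite -(inj_eq inj) relabel_nbr permKV e.
by exists (pi i); rewrite e relabel_nbr.
Qed.

Lemma relabel_root pi : relabel pi (tree_root d) = tree_root d.
Proof. exact/val_inj. Qed.

End TreeAutomorphisms.

(** * An isomorphism-invariant test for the type of a star *)

Section StarTest.
Variables (S : finType) (d : nat).
Implicit Types (t : S * d.-tuple S) (X Y : rcgraph S).

(** Test functions for local limits must respect isomorphism, and a rooted graph does not label the
    neighbors of its root; hence the quantifier over enumerations [e]. *)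
Definition has_star t X := exists e : 'I_d -> vertex X,
  [/\ injective e, forall y, Defs.adjacent (Defs.root X) y <-> exists i, y = e i,
      color (Defs.root X) = t.1 & forall i, color (e i) = tnth t.2 i].

Lemma has_star_iso t X Y : rcgraph_iso X Y -> has_star t X = has_star t Y.
Proof.
have sym (Z W : rcgraph S) : rcgraph_iso Z W -> rcgraph_iso W Z.
  case=> h [[h' hK h'K] hr ha hc]; exists h'; split=> [||u v|u].
  - by exists h.
  - by rewrite -hr hK.
  - by rewrite -ha !h'K.
  - by rewrite -hc h'K.
have imp (Z W : rcgraph S) : rcgraph_iso Z W -> has_star t Z -> has_star t W.
  case=> h [[h' hK h'K] hr ha hc] [e [ei ea er ec]]; exists (h \o e); split.
  - exact: inj_comp (can_inj hK) ei.
  - move=> y; rewrite -(h'K y) -hr ha ea; split=> -[i].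
      by move=> ->; exists i.
    by move=> /(can_inj hK) ->; exists i.
  - by rewrite -hr hc.
  - by move=> i; rewrite /= hc.
by move=> XY; apply/propext; split; apply: imp => //; exact: sym.
Qed.

(** Two injective enumerations of the neighbors of [o] by ['I_d] differ by a permutation of the
    labels. *)
Lemma has_star_ball t (V : Type) (e : rel V) (c : V -> S) (o : V) (nb : 'I_d -> V) :
  injective nb -> (forall y, e o y <-> exists i, y = nb i) ->
  has_star t (ball_at e c 1 o) <-> star_eq t (c o, [tuple c (nb i) | i < d]).
Proof.
move=> nb_inj eo; split.
  case=> l [li la lr lc].
  have /choice[pi piP] i : exists j, sval (l i) = nb j by apply/eo/(la (l i)); exists i.
  have pi_inj : injective pi.
    move=> i j eq_pi; apply: li; apply: eq_sig_hprop => [v p q|].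
      exact: Prop_irrelevance.
    by rewrite !piP eq_pi.
  rewrite /star_eq -lr /= eqxx /=; apply/(@tuple_permP _ _ _ [tuple c (nb i) | i < d]).
  exists (perm pi_inj); rewrite -[LHS]/(val t.2); congr val.
  apply: eq_from_tnth => i; rewrite -lc !tnth_mktuple permE /= piP //.
case/andP => /= /eqP tc /(@tuple_permP _ _ _ [tuple c (nb i) | i < d])[pi /val_inj tpi].
have wi i : Defs.within e 1 o (nb (pi i)).
  by exists [:: nb (pi i)]; split=> //=; rewrite andbT; apply/eo; exists (pi i).
exists (fun i => exist _ (nb (pi i)) (wi i)); split.
- by move=> i j /(congr1 sval) /= /nb_inj /perm_inj.
- move=> [y wy] /=; rewrite eo; split=> -[i].
    move=> yi; exists (pi^-1 i)%g; apply: eq_sig_hprop => [v p q|].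
      exact: Prop_irrelevance.
    by rewrite /= permKV.
  by move=> /(congr1 sval) /= ->; exists (pi i).
- by rewrite /= tc.
- by move=> i /=; rewrite tpi !tnth_mktuple.
Qed.

End StarTest.

(** * Laws of random variables with finitely many values *)

Section FiniteLaw.
Local Open Scope classical_set_scope.
Variables (R : realType) (dO : measure_display) (O : measurableType dO).
Variables (P : probability O R) (I : finType) (X : O -> I).
Hypothesis mX : forall t, measurable [set x | X x = t].

Definition law (t : I) : R := fine (P [set x | X x = t]).

Lemma event_mem (s : seq I) : uniq s ->
  measurable [set x | X x \in s] /\ P [set x | X x \in s] = (\sum_(t <- s) law t)%:E.
Proof.
elim: s => [_|t s IHs /= /andP[ts us]].
  by rewrite big_nil (_ : [set x | _] = set0) ?measure0 //; apply/seteqP; split.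
have [ms Ps] := IHs us.
have -> : [set x | X x \in t :: s] = [set x | X x = t] `|` [set x | X x \in s].
  apply/seteqP; split=> x /=; rewrite inE.
    by case/orP => [/eqP|]; [left | right].
  by case=> [->|->]; rewrite ?eqxx ?orbT.
split; first exact: measurableU.
rewrite measureU // ?Ps ?big_cons ?EFinD; last first.
  by apply/seteqP; split=> // x /= [-> /(negP ts)].
rewrite fineK; last by apply: fin_num_measure; exact: mX.
by congr (_ + _); exact: Ps.
Qed.

Lemma law_event (B : pred I) : fine (P [set x | B (X x)]) = \sum_(t | B t) law t.
Proof.
have [_] := event_mem (enum_uniq B); rewrite big_enum /= => h.
transitivity (fine (\sum_(t in B) law t)%:E); last exact: eq_bigl.
by rewrite -h; congr (fine (P _)); apply/seteqP; split=> x /=; rewrite mem_enum.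
Qed.

Lemma measurable_event (B : pred I) : measurable [set x | B (X x)].
Proof.
have [+ _] := event_mem (enum_uniq B); congr measurable.
by apply/seteqP; split=> x /=; rewrite mem_enum.
Qed.

End FiniteLaw.

(** * Star and edge marginals of an invariant process *)

Section TreeLaws.
Local Open Scope classical_set_scope.
Variables (R : realType) (d : nat) (S : pfinType).
Variable nu : probability (borel_coloring d S) R.
Hypothesis nu_inv : invariant_process nu.
Local Notation T := (S * d.-tuple S)%type.
Implicit Types (x : borel_coloring d S) (o u v : tree d).

Lemma measurable_coloring_at v (a : S) :
  measurable ([set x | x v = a] : set (borel_coloring d S)).
Proof.
apply: sub_sigma_algebra; rewrite -[X in open X]/(proj v @^-1` [set a]).
apply: open_comp => [x _|]; first exact: proj_continuous.
exact: discrete_open.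
Qed.

Lemma measurable_coloring_on (s : seq (tree d)) (a : seq S) :
  measurable ([set x | [seq x v | v <- s] = a] : set (borel_coloring d S)).
Proof.
elim: s a => [|v s IHs] [|b a].
- by rewrite (_ : mkset _ = setT); [exact: measurableT | apply/seteqP; split].
- by rewrite (_ : mkset _ = set0); [exact: measurable0 | apply/seteqP; split].
- by rewrite (_ : mkset _ = set0); [exact: measurable0 | apply/seteqP; split].
rewrite (_ : mkset _ = [set x | x v = b] `&` [set x | [seq x w | w <- s] = a]).
  by apply: measurableI; [exact: measurable_coloring_at | exact: IHs].
by apply/seteqP; split=> x /= => [[-> ->]|[-> ->]].
Qed.

Definition star_color o x : T := (x o, [tuple x (nbr o i) | i < d]).

Lemma star_colorE o x (t : T) :
  star_color o x = t <-> [seq x v | v <- star o] = t.1 :: val t.2.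
Proof.
have e : [seq x v | v <- star o] = x o :: [tuple x (nbr o i) | i < d].
  by rewrite /= -map_comp.
rewrite e; split=> [<- //|]; case: t => a b [/= xo h]; rewrite /star_color xo; congr (_, _).
exact/val_inj.
Qed.

Lemma measurable_star_color o (t : T) : measurable [set x | star_color o x = t].
Proof.
rewrite (_ : mkset _ = [set x | [seq x v | v <- star o] = t.1 :: val t.2]).
  exact: measurable_coloring_on.
by apply/seteqP; split=> x /=; rewrite star_colorE.
Qed.

Definition edge_color_at o i x : S * S := (x o, x (nbr o i)).

Lemma measurable_edge_color_at o i (t : S * S) :
  measurable [set x | edge_color_at o i x = t].
Proof.
rewrite (_ : mkset _ = [set x | [seq x v | v <- [:: o; nbr o i]] = [:: t.1; t.2]]).
  exact: measurable_coloring_on.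
apply/seteqP; split=> x /=; first by move=> <-.
by rewrite /edge_color_at; case: t => a b /= [-> ->].
Qed.

Notation star_law o := (law nu (star_color o)).
Notation edge_law_at o i := (law nu (edge_color_at o i)).

Lemma star_law_translate o : star_law o =1 star_law (tree_root d).
Proof.
move=> t; rewrite /law; congr fine.
rewrite -(nu_inv (translate_aut o) (measurable_star_color (tree_root d) t)).
by congr (nu _).
Qed.

Lemma edge_law_translate o i : edge_law_at o i =1 edge_law_at (tree_root d) i.
Proof.
move=> t; rewrite /law; congr fine.
rewrite -(nu_inv (translate_aut o) (measurable_edge_color_at (tree_root d) i t)).
by congr (nu _).
Qed.

Lemma edge_law_relabel i j : edge_law_at (tree_root d) i =1 edge_law_at (tree_root d) j.
Proof.
move=> t; rewrite /law; congr fine.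
rewrite -(nu_inv (relabel_aut (tperm i j)) (measurable_edge_color_at (tree_root d) j t)).
congr (nu _); apply: funext => x /=.
by rewrite /edge_color_at relabel_nbr relabel_root tpermR.
Qed.

Lemma star_law_exchangeable (t t' : T) : star_eq t t' ->
  star_law (tree_root d) t = star_law (tree_root d) t'.
Proof.
case/andP => /eqP t1 /tuple_permP[pi t2].
rewrite /law; congr fine.
rewrite -(nu_inv (relabel_aut pi) (measurable_star_color (tree_root d) t)).
congr (nu _); apply: funext => x; apply/propext.
rewrite /= /star_color relabel_root; case: t t' t1 t2 => a b [a' b'] /= <- bE.
have {}bE i : tnth b i = tnth b' (pi i).
  have -> : b = [tuple tnth b' (pi i) | i < d] by exact/val_inj.
  by rewrite tnth_mktuple.
split=> -[-> e]; congr (_, _); apply: eq_from_tnth => i.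
  have := congr1 (fun w => tnth w (pi^-1 i)%g) e.
  by rewrite !tnth_mktuple relabel_nbr relabel_root bE permKV.
by rewrite bE -e !tnth_mktuple relabel_nbr relabel_root.
Qed.

Lemma joint_entropy_star o : joint_entropy nu (star o) = entropy (star_law (tree_root d)).
Proof.
have sz : (d.+1 = size (star o))%N by rewrite /= size_map size_enum_ord.
(* The cast is needed because [size (star o)] equals [d.+1] only up to a proved equation. *)
pose h (t : T) : (size (star o)).-tuple S := tcast sz [tuple of t.1 :: t.2].
have hE t : tval (h t) = t.1 :: t.2 by rewrite /h val_tcast.
have h_inj : injective h.
  by move=> [a b] [a' b'] /(congr1 (@tval _ _)); rewrite !hE => -[/= -> /val_inj ->].
have h_bij : bijective h.
  by apply: inj_card_bij => //; rewrite card_prod !card_tuple -sz expnS.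
rewrite /joint_entropy /entropy; congr (- _).
rewrite (reindex h) /=; last exact: onW_bij.
apply: eq_bigr => t _; suff -> : marginal nu (star o) (h t) = star_law (tree_root d) t by [].
rewrite -(star_law_translate o) /marginal /law; congr (fine (nu _)).
by apply/seteqP; split=> x /=; rewrite hE star_colorE.
Qed.

Lemma joint_entropy_edge u v i0 : tree_adj u v ->
  joint_entropy nu [:: u; v] = entropy (edge_law_at (tree_root d) i0).
Proof.
case/existsP => i /eqP ->.
pose h (t : S * S) : 2.-tuple S := [tuple t.1; t.2].
have h_inj : injective h by move=> [a b] [a' b'] /(congr1 val) [-> ->].
have h_bij : bijective h.
  by apply: inj_card_bij => //; rewrite card_prod !card_tuple.
rewrite /joint_entropy /entropy; congr (- _).
rewrite (reindex h) /=; last exact: onW_bij.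
apply: eq_bigr => t _.
suff -> : marginal nu [:: u; nbr u i] (h t) = edge_law_at (tree_root d) i0 t by [].
rewrite -(edge_law_relabel i) -(edge_law_translate u) /marginal /law; congr (fine (nu _)).
apply/seteqP; split=> x /=; rewrite /edge_color_at; first by case: t => a b [-> ->].
by move=> <-.
Qed.

(** The left side averages over the [d] directions at the root, and by invariance the edge law is
    the same in each of them. *)
Lemma edge_law_star i0 (ab : S * S) : edge_law (star_law (tree_root d)) ab = edge_law_at (tree_root d) i0 ab.
Proof.
have e i : edge_law_at (tree_root d) i0 ab =
    \sum_(t | edge_color t i == ab) star_law (tree_root d) t.
  rewrite (edge_law_relabel i0 i) -(law_event _ (measurable_star_color (tree_root d))).
  congr (fine (nu _)); apply/seteqP; split=> c /=; rewrite /edge_color /edge_color_at /= tnth_mktuple.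
    by move=> ->.
  by move/eqP.
rewrite /edge_law; under eq_bigr do rewrite /edge_mult -sum1dep_card natr_sum mulr_sumr.
rewrite (exchange_big_dep predT) //=.
rewrite (eq_bigr (fun=> edge_law_at (tree_root d) i0 ab)) => [|i _]; last first.
  by rewrite (e i); apply: eq_bigr => t _; rewrite mulr1.
rewrite sumr_const card_ord -(mulr_natl (edge_law_at (tree_root d) i0 ab)) mulrA mulVf ?mul1r //.
by rewrite pnatr_eq0 -lt0n (leq_ltn_trans _ (ltn_ord i0)).
Qed.

(** The test accepts the whole class of [t], and exchangeability makes the star law constant on this
    class. *)
Lemma integral_has_star (t : T) :
  \int[nu]_x (`[< has_star t (ball_at (@tree_adj d) x 1 (tree_root d)) >])%:R =
  #|star_eq t|%:R * star_law (tree_root d) t.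
Proof.
have e x : `[< has_star t (ball_at (@tree_adj d) x 1 (tree_root d)) >] =
    star_eq t (star_color (tree_root d) x).
  have root_adj y : tree_adj (tree_root d) y <-> exists i, y = nbr (tree_root d) i.
    split=> [/existsP[i /eqP ->]|[i ->]]; first by exists i.
    by apply/existsP; exists i.
  have hb := @has_star_ball S d t _ (@tree_adj d) x _ _ (@nbr_inj d (tree_root d)) root_adj.
  by apply/asboolP/idP => /hb.
rewrite /Rintegral.
have mA := measurable_event nu (measurable_star_color (tree_root d)) (star_eq t).
under eq_integral => x _.
  rewrite e (_ : _%:R = \1_[set x | star_eq t (star_color (tree_root d) x)] x); last first.
    by rewrite indicE; congr ((nat_of_bool _)%:R); apply/idP/idP; rewrite inE.
  over.
rewrite integral_indic // setIT law_event; last exact: measurable_star_color.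
rewrite mulr_natl -sumr_const; apply: eq_bigr => t' tt'.
by rewrite (star_law_exchangeable tt').
Qed.

End TreeLaws.

(** * Typical processes *)

Section EventuallyOften.
Local Open Scope classical_set_scope.
Variables (R : realType) (dO : measure_display) (O : measurableType dO).
Variable P : probability O R.

(** The tail intersections increase to an event of probability 1, so their probabilities tend to 1
    and cannot all stay at or below one half. *)
Lemma eventually_ae_half (E : nat -> set O) (j : nat) :
  (forall i, measurable (E i)) ->
  (\forall w \ae P, \forall i \near \oo, E i w) ->
  exists2 i, (j <= i)%N & (2^-1%:E <= P (E i))%E.
Proof.
move=> mE aeE; apply: contrapT => noi.
have small i : (j <= i)%N -> (P (E i) <= 2^-1%:E)%E.
  by move=> ji; rewrite leNgt; apply/negP => /ltW h; apply: noi; exists i.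
pose F m := \bigcap_(i in [set i | (m + j <= i)%N]) E i.
have mF m : measurable (F m) by apply: bigcap_measurable => // ; exists (m + j)%N => /=.
have mU : measurable (\bigcup_m F m) by exact: bigcup_measurable.
have cvgF : (P \o F @ \oo --> P (\bigcup_m F m)).
  apply: nondecreasing_cvg_mu => // m m' mm'; apply/subsetPset => w Fw i /= m'i.
  by apply: Fw; rewrite /=; apply: leq_trans m'i; rewrite leq_add2r.
have PU : P (\bigcup_m F m) = 1%E.
  have [N [mN PN NE]] := aeE.
  have : P (~` \bigcup_m F m) = 0%E.
    apply: (subset_measure0 (B := N)) => //; first exact: measurableC.
    move=> w nFw; apply: NE => -[m _ mP]; apply: nFw.
    exists m => // i /= mi; apply: mP => /=; apply: leq_trans mi; exact: leq_addr.
  by rewrite probability_setC // => /eqP; rewrite sube_eq ?add0e ?fin_num_measure // => /eqP ->.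
have : (1 <= 2^-1%:E :> \bar R)%E.
  rewrite -PU; apply: (@cvge_le _ _ _ _ _ _ _ _ cvgF).
  apply: nearW => m; apply: (@le_trans _ _ (P (E (m + j)%N))).
    by apply: le_measure; rewrite ?inE // => w; apply => /=.
  by apply: small; exact: leq_addl.
by rewrite lee_fin; lra.
Qed.

End EventuallyOften.

(** * From local limits of random graphs to counts of pairings *)

Section TypicalGraphs.
Local Open Scope classical_set_scope.
Variables (R : realType) (d : nat) (S : pfinType).
Local Notation T := (S * d.-tuple S)%type.

Definition star_stat n (G : dgraph d n) (c : 'I_n -> S) (t : T) : R :=
  \sum_(v < n) (`[< has_star t (ball_at (gadj G) c 1 v) >])%:R.

Lemma star_statE n (G : dgraph d n) (f : {ffun 'I_n * 'I_d -> 'I_n * 'I_d}) c t :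
  f \in simple_pairings 'I_n d 0 -> pairing_adj f = val G ->
  star_stat G (c : {ffun 'I_n -> S}) t =
  \sum_(t' | star_eq t t') (type_count (star_types f c) t')%:R.
Proof.
move=> /perfectP[_ _ fi] fG.
pose F (t' : T) : nat := star_eq t t'.
rewrite big_mkcond /= (eq_bigr (fun t' => (type_count (star_types f c) t' * F t')%N%:R)); last first.
  by move=> t' _; rewrite /F; case: ifP => _; rewrite ?muln1 ?muln0.
rewrite -natr_sum -sum_type_count natr_sum; apply: eq_bigr => v _.
have adjE y : gadj G v y <-> exists i, y = (f (v, i)).1.
  rewrite /gadj -fG ffunE /=; split=> [/existsP[i /eqP <-]|[i ->]]; first by exists i.
  by apply/existsP; exists i.
have hb := @has_star_ball S d t _ (gadj G) c v _ (fi v) adjE.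
congr ((nat_of_bool _)%:R); rewrite ffunE.
by apply/asboolP/idP => /hb.
Qed.

Variable nu : probability (borel_coloring d S) R.
Hypothesis nu_inv : invariant_process nu.
Local Notation p := (law nu (star_color (tree_root d))).

Definition good_graphs n (eps : R) : {set dgraph d n} :=
  [set G | `[< exists c : 'I_n -> S, forall t,
     `|star_stat G c t / n%:R - #|star_eq t|%:R * p t| <= eps >]]%SET.

Lemma good_graphs_pairings n eps : (0 < n)%N ->
  (#|{: dgraph d n}| <= 2 * #|good_graphs n eps|)%N ->
  (#|simple_pairings 'I_n d 0| <= 2 * #|near_pairings n p eps|)%N.
Proof.
move=> n0 half; rewrite card_perfect_graphs.
apply: leq_trans (leq_mul half (leqnn _)) _.
rewrite -mulnA leq_mul2l /= -card_pairings_of_graphs.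
apply/subset_leq_card/fintype.subsetP => f /finset.setIdP[fP /imsetP[G]].
rewrite inE => /asboolP[c cP] fG; rewrite inE fP /=.
apply/existsP; exists [ffun v => c v]; apply/forallP => t.
have cl0 : 0 < #|star_eq t|%:R :> R by rewrite ltr0n (card_class_gt0 (@star_eq_refl S d)).
have := cP t.
have -> : star_stat G c t = star_stat G [ffun v => c v] t.
  by congr (star_stat G _ t); apply: funext => v; rewrite ffunE.
rewrite (star_statE _ _ fP fG) /type_freq /symmetrize => h.
(* Passing from a class total to the average over the class divides the error by the class size,
   which is at least 1. *)
rewrite -(ler_pM2l cl0); apply: le_trans (_ : eps <= _); last first.
  have eps0 := le_trans (normr_ge0 _) h.
  by rewrite ler_peMl // ler1n (card_class_gt0 (@star_eq_refl S d)).
apply: le_trans h; rewrite -[X in X * `|_|](ger0_norm (ltW cl0)) -normrM mulrBr.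
by rewrite mulrA [_%:R * (_ / _)]mulrC divfK ?lt0r_neq0.
Qed.

(** Balls of radius 1 suffice: almost surely the sampled graphs are eventually good, so at
    arbitrarily late indices a graph is good with probability at least one half. By uniformity at
    least half of all graphs of that size are good. *)
Lemma typical_frequent : typical nu -> forall (eps : R) (j : nat), 0 < eps ->
  exists n, [/\ (j <= n)%N, ~~ odd (n * d) &
    (#|simple_pairings 'I_n d 0| <= 2 * #|near_pairings n p eps|)%N].
Proof.
move=> [n_ [n_gt0 n_even n_oo [dO [Om [P [G [Gunif _ Glim]]]]]]] eps j eps0.
have mG i t : measurable [set w | G i w = t] by case: (Gunif i t).
pose E i := [set w | G i w \in good_graphs (n_ i) eps].
have mE i : measurable (E i) := measurable_event P (mG i) (mem (good_graphs (n_ i) eps)).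
have aeE : \forall w \ae P, \forall i \near \oo, E i w.
  apply: filterS Glim => w [_ _ [f flim]].
  (* Convergence is tested against [has_star t]; since there are finitely many [t], the bounds
     eventually hold for all of them at once. *)
  have near_t (t : T) : \forall i \near \oo,
      `|star_stat (G i w) (f i) t / (n_ i)%:R - #|star_eq t|%:R * p t| <= eps.
    have := flim 1%N (fun X => (`[< has_star t X >])%:R).
    rewrite integral_has_star // => h.
    have {h} : star_stat (G i w) (f i) t / (n_ i)%:R @[i --> \oo] --> #|star_eq t|%:R * p t.
      apply: h => [X Y XY|]; first by rewrite (has_star_iso t XY).
      by exists 1 => X; case: `[< _ >]; rewrite ?normr1 ?normr0.
    by move=> /cvgrPdist_le/(_ eps eps0) h; apply: filterS h => i; rewrite distrC.
  apply: filterS (filter_forall _ near_t) => i iP.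
  by rewrite /E /= inE; apply/asboolP; exists (f i).
have [i0 _ i0P] : \forall i \near \oo, (j <= n_ i)%N := n_oo _ (nbhs_infty_ge j).
have [i i0i Pi] := eventually_ae_half i0 mE aeE.
exists (n_ i); split; [exact: i0P | by rewrite mulnC | apply: good_graphs_pairings => //].
have lawE t : law P (G i) t = #|{: dgraph d (n_ i)}|%:R^-1.
  by rewrite /law; have [_ ->] := Gunif i t.
have := law_event P (mG i) (mem (good_graphs (n_ i) eps)).
under eq_bigr do rewrite lawE.
rewrite sumr_const => PE.
have fE : P (E i) \is a fin_num by exact: fin_num_measure.
move: Pi; rewrite -(fineK fE) lee_fin PE.
have [->//|T0] := posnP #|{: dgraph d (n_ i)}|.
rewrite -[leRHS]mulr_natl ler_pdivlMr ?ltr0n // => h.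
rewrite -(ler_nat R) natrM; lra.
Qed.

End TypicalGraphs.

Theorem theorem4 (R : realType) (d : nat) (S : pfinType)
    (nu : probability (borel_coloring d S) R) :
  (2 <= d)%N -> invariant_process nu -> typical nu ->
  forall o u v : tree d, tree_adj u v ->
    joint_entropy nu (star o) >= d%:R / 2 * joint_entropy nu [:: u; v].
Proof.
move=> d2 nu_inv nu_typ o u v uv; have d0 : (0 < d)%N by apply: ltnW.
rewrite (joint_entropy_star nu_inv) (joint_entropy_edge nu_inv (Ordinal d0) uv).
have := first_moment_limit d0 (typical_frequent nu_inv nu_typ).
rewrite (funext (edge_law_star nu_inv (Ordinal d0))); lra.
Qed.
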